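(* Let $U\subset\mathbb R^n$ be a smoothly bounded strictly convex domain, let $\varphi_0,\varphi_1\in\mathcal S$, and let $u$ be the weak geodesic joining $\varphi_0$ and $\varphi_1$. Then $u$ is $C^{1,1}$ regular away from the corner points $\partial U\times\{0\}\cup\partial U\times\{1\}$. Moreover, for any neighborhood $W$ of $\partial U\times\{0,1\}$ such that $U\times[0,1]\setminus W$ is convex, there is a constant $C_W$, depending on $W$, $U$ and $\varphi_0,\varphi_1$, such that $$\|u\|_{C^{1,1}(\overline{U\times[0,1]}\setminus W)}\leq C_W.$$
   Context: For a smoothly bounded strictly convex domain $U\subset\mathbb R^n$, $$\mathcal S:=\{v\in C^\infty(\overline U)\ |\ D^2v>0 \text{ on } \overline U,\ v=0\text{ on }\partial U\}.$$ Given $\varphi_0,\varphi_1\in\mathcal S$, the weak geodesic joining $\varphi_0$ and $\varphi_1$ is the unique convex function $u$ on $U\times(0,1)$, continuous up to the boundary, which solves $$\det(D^2_{x,t}u)=0\ \text{ in } U\times(0,1),\quad u(\cdot,0)=\varphi_0\ \text{ on }U,\quad u(\cdot,1)=\varphi_1\ \text{ on }U,\quad u=0\ \text{ on }\partial U\times(0,1),$$ where $D^2_{x,t}u$ is the Hessian in all variables $(x,t)$ and the equation is understood in the weak (Alexandrov) sense, i.e. the Monge-Ampère measure of $u$ vanishes on $U\times(0,1)$. *)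

(* Defs.v *)
From HB Require Import structures.
From mathcomp Require Import all_boot all_order all_algebra.
From mathcomp Require Import all_classical all_reals all_analysis.
Import Order.TTheory GRing.Theory Num.Theory.
Import numFieldNormedType.Exports.

Set Implicit Arguments.
Unset Strict Implicit.
Unset Printing Implicit Defensive.

Local Open Scope classical_set_scope.
Local Open Scope ring_scope.

(* R^m is 'rV[R]_m.  Its library norm is the max norm, which is equivalent to
   the Euclidean one. *)

Section Calculus.
Context {R : realType} {m : nat}.
Implicit Types (f : 'rV[R]_m -> R) (A : set 'rV[R]_m) (z : 'rV[R]_m).

Definition pderiv (i : 'I_m) f : 'rV[R]_m -> R :=
  fun z => 'D_(delta_mx 0 i) f z.

(* [pderivs [:: i1; ..; ik] f] is d_i1 (.. (d_ik f)). *)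
Definition pderivs (s : seq 'I_m) f : 'rV[R]_m -> R := foldr pderiv f s.

Definition grad f z : 'rV[R]_m := \row_i pderiv i f z.

(* C^infty on an open set: every iterated partial derivative exists and is
   differentiable, hence continuous. *)
Definition smooth_on A f : Prop :=
  forall (s : seq 'I_m) z, A z -> differentiable (pderivs s f) z.

(* C^infty(closure A) for an open set A: f is continuous on the closure,
   smooth in A, and each of its derivatives has a continuous extension to
   the closure.  Only the values of f on the closure of A matter. *)
Definition smooth_closure A f : Prop :=
  [/\ {within closure A, continuous f},
      smooth_on A f
    & forall (s : seq 'I_m) z, closure A z ->
        cvg (pderivs s f y @[y --> within A (nbhs z)])].

(* The Hessian on the closure of A, by continuous extension from A. *)
Definition hessian_closure A f z : 'M[R]_m :=
  \matrix_(i, j) lim (pderivs [:: i; j] f y @[y --> within A (nbhs z)]).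

Definition posdef (M : 'M[R]_m) : Prop :=
  forall v : 'rV[R]_m, v != 0 -> 0 < (v *m M *m v^T) 0 0.

Definition bdry A : set 'rV[R]_m := closure A `\` A°.

(* C^1 in the open set A, with a gradient extending continuously to A u K. *)
Definition C1_upto A (K : set 'rV[R]_m) f : Prop :=
  (forall z, A z -> differentiable f z) /\
  (forall z, (A `|` K) z -> cvg (grad f y @[y --> within A (nbhs z)])).

Definition grad_closure A f z : 'rV[R]_m :=
  lim (grad f y @[y --> within A (nbhs z)]).

(* The C^{1,1} norm on K, a subset of the closure of the open set A; the
   gradient is taken in A and extended continuously to K.  The value is
   meaningful when [C1_upto A K f].  The element 0 makes each supremum
   nonnegative when it ranges over an empty set. *)
Definition C11_norm A (K : set 'rV[R]_m) f : \bar R :=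
  (ereal_sup (0%E |` [set `|f z|%:E | z in K]) +
   ereal_sup (0%E |` [set `|grad_closure A f z|%:E | z in K]) +
   ereal_sup (0%E |`
     [set (`|grad_closure A f p.1 - grad_closure A f p.2| / `|p.1 - p.2|)%:E
       | p in [set p | [/\ K p.1, K p.2 & p.1 != p.2]]]))%E.

(* f is C^{1,1} on B, a relatively open part of the closure of the open set A:
   locally C^{1,1}, up to the boundary points of A that lie in B. *)
Definition C11_loc A (B : set 'rV[R]_m) f : Prop :=
  C1_upto A B f /\
  forall z, B z ->
    exists2 N, nbhs z N & (C11_norm A (N `&` B) f < +oo)%E.

End Calculus.

Section MongeAmpere.
Context {R : realType} {m : nat}.

Definition box (a b : 'rV[R]_m) : set 'rV[R]_m :=
  [set z | forall i, a 0 i <= z 0 i <= b 0 i].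

(* The m-dimensional Lebesgue outer measure. *)
Definition lebesgue_outer (E : set 'rV[R]_m) : \bar R :=
  ereal_inf [set v | exists a b : nat -> 'rV[R]_m,
    [/\ forall k i, a k 0 i <= b k 0 i,
        E `<=` \bigcup_k box (a k) (b k)
      & v = (\sum_(k <oo) (\prod_i (b k 0 i - a k 0 i))%:E)%E]].

Definition subdiff (A : set 'rV[R]_m) (u : 'rV[R]_m -> R) (z : 'rV[R]_m)
  : set 'rV[R]_m :=
  [set p | forall w, A w -> u z + (p *m (w - z)^T) 0 0 <= u w].

(* The (Alexandrov) Monge-Ampere measure of the convex function u on A. *)
Definition MA_measure (A : set 'rV[R]_m) (u : 'rV[R]_m -> R)
  (E : set 'rV[R]_m) : \bar R :=
  lebesgue_outer (\bigcup_(z in E) subdiff A u z).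

End MongeAmpere.

Section Geodesics.
Context {R : realType} {n : nat}.
Implicit Types (U : set 'rV[R]_n) (phi : 'rV[R]_n -> R).

Definition smooth_bdry U : Prop :=
  forall p, bdry U p -> exists (O : set 'rV[R]_n) (rho : 'rV[R]_n -> R),
    [/\ open O, O p, smooth_on O rho, grad rho p != 0
      & U `&` O = [set x | rho x < 0] `&` O].

Definition strictly_convex U : Prop :=
  forall x y, closure U x -> closure U y -> x != y ->
    forall t : R, 0 < t < 1 -> U° (t *: x + (1 - t) *: y).

Definition smooth_strictly_convex_domain U : Prop :=
  [/\ U !=set0, open U & connected U] /\
  [/\ bounded_set U, smooth_bdry U & strictly_convex U].

Definition class_S U : set ('rV[R]_n -> R) :=
  [set v | [/\ smooth_closure U v,
               forall x, closure U x -> posdef (hessian_closure U v x)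
             & forall x, bdry U x -> v x = 0]].

(* The point (x, t) of R^n x R. *)
Definition pt (x : 'rV[R]_n) (t : R) : 'rV[R]_(n + 1) := row_mx x (t%:M).

Definition cylinder U (J : set R) : set 'rV[R]_(n + 1) :=
  [set pt xt.1 xt.2 | xt in U `*` J].

Definition weak_geodesic U phi0 phi1 (u : 'rV[R]_(n + 1) -> R) : Prop :=
  let Q := cylinder U (`]0, 1[) in
  [/\ convex_function Q u,
      {within closure Q, continuous u}
    & MA_measure Q u Q = 0%E] /\
  [/\ forall x, U x -> u (pt x 0) = phi0 x,
      forall x, U x -> u (pt x 1) = phi1 x
    & forall x t, bdry U x -> 0 < t < 1 -> u (pt x t) = 0].

Definition corners U : set 'rV[R]_(n + 1) := cylinder (bdry U) [set 0; 1].

End Geodesics.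

(* Main.v *)
Require Import Defs.
From HB Require Import structures.
From mathcomp Require Import all_boot all_order all_algebra.
From mathcomp Require Import all_classical all_reals all_analysis.
From mathcomp Require Import measurable_realfun.
From mathcomp Require Import ring lra.
Import Order.TTheory GRing.Theory Num.Theory.
Import numFieldNormedType.Exports.
Set Implicit Arguments.
Unset Strict Implicit.
Unset Printing Implicit Defensive.

Local Open Scope classical_set_scope.
Local Open Scope ring_scope.

(** The idea is that the geodesic is explicit and that its C^{1,1} bound can be
    read off from the formula.  Both data vanish on the boundary of U, so a
    lateral boundary point (y, s) is a convex combination of the corners (y, 0)
    and (y, 1) with the same boundary value 0, and the lateral boundary is
    invisible to the convex envelope.  Hence
      u(x, t) = min { (1 - t) phi0(x0) + t phi1(x1) },
    where x0, x1 run over the closure of U with (1 - t) x0 + t x1 = x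
    ([geodesic_decomposition]).  The inequality <= is convexity.  For >=, the
    minimizers cannot both lie on the boundary, because the value would then
    be 0 whereas the data are negative inside; the interior one has a tangent
    plane, and by the first-order condition its slope p is also a slope of
    support at the other minimizer ([common_slope]).  The affine function with
    slope p through the two values lies below u on the boundary of the
    cylinder, hence below u inside: otherwise the subgradients of u would fill a
    neighbourhood of its slope and the Monge-Ampere measure would be positive
    ([affine_below_of_MA0]).

    For the regularity, one of the minimizers is held fixed and the other one,
    in the interior of U, say x1, absorbs a displacement of (x, t).  This is
    possible for small displacements only, but it puts above u a paraboloid
    whose opening is C / t with C depending on the data and the diameter alone:
    the distance from x1 to the boundary of U does not enter
    ([touched_of_moving]).  When x0 is the interior one the opening is
    C / (1 - t).  If x0 is on the boundary, then (x, t) is within distance of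
    order t of the corner (x0, 0), so that the opening is controlled by the
    inverse distance to the corners ([geodesic_touched]).

    A convex function with a paraboloid above it at every point is
    differentiable, and its gradient deviates from the value at that point at
    most at a linear rate, which depends on the opening but not on the range
    where the paraboloid is above ([touched_grad_near]).  These pointwise estimates add up
    along segments ([grad_lipschitz_segment]), and a Lipschitz gradient extends
    to the boundary.  Pairs of points that are far apart compared with their
    distance to the corners are handled by the global gradient bound. *)

(** * Linear forms and derivatives on row vectors *)
Section RowVectors.
Context {R : realType} {m : nat}.
Implicit Types (p q h x y z : 'rV[R]_m) (f : 'rV[R]_m -> R).

Definition dot p h : R := \sum_i p 0 i * h 0 i.

Lemma mulmx_trE p h : (p *m h^T) 0 0 = dot p h.
Proof. by rewrite mxE; apply: eq_bigr => i _; rewrite mxE. Qed.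

Lemma dot_is_linear p : linear (dot p).
Proof.
move=> a x y; rewrite /dot /= scaler_sumr -big_split /=.
by apply: eq_bigr => i _; rewrite !mxE mulrDr mulrCA.
Qed.
HB.instance Definition _ p :=
  GRing.isLinear.Build R 'rV[R]_m R _ (dot p) (dot_is_linear p).

Lemma dotDr p x y : dot p (x + y) = dot p x + dot p y.
Proof. exact: raddfD. Qed.
Lemma dotBr p x y : dot p (x - y) = dot p x - dot p y.
Proof. exact: raddfB. Qed.
Lemma dotNr p x : dot p (- x) = - dot p x.
Proof. exact: raddfN. Qed.
Lemma dotZr p a x : dot p (a *: x) = a * dot p x.
Proof. exact: linearZ. Qed.
Lemma dot0r p : dot p 0 = 0.
Proof. exact: raddf0. Qed.
Lemma dotC p q : dot p q = dot q p.
Proof. by apply: eq_bigr => i _; rewrite mulrC. Qed.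
Lemma dotBl p q x : dot (p - q) x = dot p x - dot q x.
Proof. by rewrite !(dotC _ x) dotBr. Qed.

Lemma dot_delta p i : dot p (delta_mx 0 i) = p 0 i.
Proof.
rewrite /dot (bigD1 i) //= mxE !eqxx mulr1 big1 ?addr0 // => j ji.
by rewrite mxE (negbTE ji) andbF mulr0.
Qed.

Lemma coord_le_norm h i : `|h 0 i| <= `|h|.
Proof.
rewrite [leRHS]/Num.norm /= mx_normrE; apply/bigmax_geP; right => /=.
by exists (0, i).
Qed.

Lemma norm_le_coord h (c : R) : 0 <= c -> (forall i, `|h 0 i| <= c) -> `|h| <= c.
Proof.
move=> c0 hc; rewrite [leLHS]/Num.norm /= mx_normrE; apply/bigmax_leP; split => //=.
by case=> i j _ /=; rewrite ord1.
Qed.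

Lemma dot_le p h (a b : R) : `|p| <= a -> `|h| <= b -> `|dot p h| <= m%:R * a * b.
Proof.
move=> pa hb; apply: le_trans (ler_norm_sum _ _ _) _.
apply: (@le_trans _ _ (\sum_(i < m) a * b)).
  apply: ler_sum => i _; rewrite normrM ler_pM //.
    exact: le_trans (coord_le_norm _ _) pa.
  exact: le_trans (coord_le_norm _ _) hb.
by rewrite sumr_const card_ord -mulrA mulr_natl.
Qed.

Lemma dot_continuous p : continuous (dot p).
Proof.
apply: bounded_linear_continuous; apply/linear_boundedP => //.
near=> r => x.
apply: le_trans (dot_le (lexx _) (lexx _)) _.
by rewrite ler_wpM2r //; near: r; apply: nbhs_pinfty_ge; rewrite num_real.
Unshelve. all: by end_near. Qed.

(** Quadratic contact with an affine function determines the gradient; every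
    gradient of a geodesic below is computed in this way. *)
Lemma diff_of_quadratic f z p (K : R) :
  (\forall h \near (0 : 'rV[R]_m), `|f (z + h) - f z - dot p h| <= K * `|h| ^+ 2) ->
  differentiable f z /\ grad f z = p.
Proof.
move=> fK.
have key (e : R) : 0 < e -> \forall h \near (0 : 'rV[R]_m),
    `|f (h + z) - (f z + dot p h)| <= e * `|h|.
  move=> e0.
  have e' : 0 < e / (`|K| + 1) by rewrite divr_gt0 // ltr_wpDl.
  near=> h; rewrite [h + z]addrC opprD addrA.
  have h1 : `|h| <= e / (`|K| + 1).
    near: h; apply/nbhs_ballP; exists (e / (`|K| + 1)) => //= y.
    by rewrite -ball_normE /= sub0r normrN => /ltW.
  apply: (@le_trans _ _ (K * `|h| ^+ 2)); first by near: h.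
  rewrite expr2 mulrA ler_wpM2r //.
  apply: (@le_trans _ _ ((`|K| + 1) * `|h|)); last first.
    by rewrite mulrC -ler_pdivlMr // ltr_wpDl.
  by rewrite ler_wpM2r // (le_trans (ler_norm _)) // lerDl.
have dE : 'd f z = dot p :> ('rV[R]_m -> R).
  by apply: diff_unique; [exact: dot_continuous|apply/eqaddoP => e /key].
have df : differentiable f z.
  apply/diff_locallyP; rewrite dE; split; first exact: dot_continuous.
  by apply/eqaddoP => e /key.
split => //; apply/rowP => i; rewrite mxE /pderiv deriveE // dE.
exact: dot_delta.
Unshelve. all: by end_near. Qed.

Lemma derive_dot f z h : differentiable f z -> 'D_h f z = dot (grad f z) h.
Proof.
move=> df; rewrite deriveE // {1}(row_sum_delta h) linear_sum /=.
apply: eq_bigr => i _; rewrite linearZ /= mxE /pderiv deriveE //.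
by rewrite mulrC.
Qed.

End RowVectors.

(** * Convex functions touched from above by paraboloids *)
Section ConvexTouched.
Context {R : realType} {m : nat}.
Implicit Types (p q h x y z w : 'rV[R]_m) (f : 'rV[R]_m -> R) (A : set 'rV[R]_m).

Definition convex_dom A := forall x y (s : R), A x -> A y -> 0 <= s <= 1 ->
  A (s *: x + (1 - s) *: y).

Definition convex_on A f := forall x y (s : R), A x -> A y -> 0 <= s <= 1 ->
  f (s *: x + (1 - s) *: y) <= s * f x + (1 - s) * f y.

(** The radius e may degenerate from point to point while the opening K stays
    fixed: only K enters the estimates. *)
Definition touched f z p (K : R) :=
  exists2 e : R, 0 < e & forall h, `|h| < e ->
    f (z + h) <= f z + dot p h + K * `|h| ^+ 2.

Lemma open_ball A z : open A -> A z ->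
  exists2 e : R, 0 < e & forall h, `|h| < e -> A (z + h).
Proof.
move=> oA Az; have /nbhs_ballP[e /= e0 eA] : nbhs z A by exact: open_nbhs_nbhs.
exists e => // h he; apply: eA.
by rewrite -ball_normE /= opprD addrA subrr sub0r normrN.
Qed.

(** Dividing a first-order inequality by its small parameter. *)
Lemma ge0_of_small (c B e : R) : 0 < e ->
  (forall t, 0 < t -> t < e -> 0 <= c + t * B) -> 0 <= c.
Proof.
move=> e0 H; rewrite leNgt; apply/negP => c0.
pose t := Num.min (e / 2) (- c / (2 * (`|B| + 1))).
have B1 : 0 < `|B| + 1 by rewrite ltr_wpDl.
have t0 : 0 < t by rewrite lt_min !divr_gt0 ?oppr_gt0 ?mulr_gt0.
have te : t < e by rewrite /t gt_min; apply/orP; left; lra.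
have := H t t0 te.
have : t * B <= t * (`|B| + 1).
  by rewrite ler_pM2l // (le_trans (ler_norm _)) // lerDl.
have : t * (`|B| + 1) <= - c / 2.
  rewrite -ler_pdivlMr // -mulrA -invfM /t ge_min; apply/orP; right; lra.
by lra.
Qed.

(** The point z lies between w and z - t (w - z); convexity bounds f z by the
    values there, the second of which is bounded by the paraboloid, and t tends
    to 0. *)
Lemma touched_subgrad A B f z p K : open A -> A `<=` B -> convex_on B f ->
  A z -> touched f z p K -> forall w, B w -> f z + dot p (w - z) <= f w.
Proof.
move=> oA AB cf Az [e e0 ft] w Bw.
have [e' e'0 zA] := open_ball oA Az.
set h := w - z.
rewrite -subr_ge0.
have N0 : 0 < `|h| + 1 by rewrite ltr_wpDl.
apply: (@ge0_of_small _ (K * `|h| ^+ 2) (Num.min e e' / (`|h| + 1))).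
  by rewrite divr_gt0 // lt_min e0.
move=> t t0; rewrite ltr_pdivlMr // => te.
have hn : `| - (t *: h)| < Num.min e e'.
  rewrite normrN normrZ gtr0_norm //; apply: le_lt_trans te.
  by rewrite ler_pM2l // lerDl.
have /andP[h1 h2] : (`| - (t *: h)| < e) && (`| - (t *: h)| < e').
  by rewrite -lt_min.
have := ft _ h1; have Az' := zA _ h2.
rewrite dotNr dotZr normrN normrZ gtr0_norm // exprMn => F1.
have t1 : 0 < 1 + t by rewrite addr_gt0.
have s01 : 0 <= t / (1 + t) <= 1.
  by apply/andP; split; [rewrite divr_ge0 // ltW | rewrite ler_pdivrMr //; lra].
have := cf w (z - t *: h) _ Bw (AB _ Az') s01.
have -> : t / (1 + t) *: w + (1 - t / (1 + t)) *: (z - t *: h) = z.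
  apply/rowP => i; rewrite /h !mxE; field; exact: lt0r_neq0.
rewrite -(ler_pM2r t1) => F2.
have E : (t / (1 + t) * f w + (1 - t / (1 + t)) * f (z - t *: h)) * (1 + t)
   = t * f w + f (z - t *: h) by field; exact: lt0r_neq0.
rewrite {}E in F2.
rewrite -(pmulr_rge0 _ t0); nra.
Qed.

(** The supporting plane of [touched_subgrad] has the slope of the paraboloid, so
    f is squeezed between the two. *)
Lemma touched_diff A f z p K : open A -> convex_on A f -> A z ->
  touched f z p K -> differentiable f z /\ grad f z = p.
Proof.
move=> oA cf Az ft; have sg := touched_subgrad oA (@subset_refl _ _) cf Az ft.
have [e e0 fe] := ft; have [e' e'0 zA] := open_ball oA Az.
apply: (@diff_of_quadratic _ _ _ _ _ `|K|).
apply/nbhs_ballP; exists (Num.min e e') => /=; first by rewrite lt_min e0.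
move=> h; rewrite -ball_normE /= sub0r normrN lt_min => /andP[h1 h2].
have := sg _ (zA _ h2); rewrite [z + h - z]addrC addKr => F1.
have F2 := fe _ h1.
have F3 : K * `|h| ^+ 2 <= `|K| * `|h| ^+ 2.
  by rewrite ler_wpM2r ?exprn_ge0 // ler_norm.
rewrite ler_norml; apply/andP; split; last lra.
have : 0 <= `|K| * `|h| ^+ 2 by rewrite mulr_ge0 // exprn_ge0.
lra.
Qed.

(** For w of the size of h, the supporting plane at z + h is compared at z + h + w
    with the paraboloid at z, of height at most 4 K |h|^2 above the tangent plane
    there.  The radius of the paraboloid only limits the size of h. *)
Lemma touched_grad_near A f z p K : open A -> convex_on A f -> A z ->
  (forall w, A w -> exists q L, touched f w q L) ->
  touched f z p K -> 0 <= K ->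
  exists2 e : R, 0 < e & forall h, `|h| < e ->
    `|grad f (z + h) - grad f z| <= 4 * K * `|h|.
Proof.
move=> oA cf Az fT ft K0; have [e e0 fe] := ft.
have [e' e'0 zA] := open_ball oA Az.
have [_ gz] := touched_diff oA cf Az ft.
exists (Num.min e e' / 2); first by rewrite divr_gt0 // lt_min e0.
move=> h hlt.
have /andP[h1 h2] : (`|h| * 2 < e) && (`|h| * 2 < e').
  by rewrite -lt_min -ltr_pdivlMr.
have hp : 0 <= `|h| by [].
have [->|hn0] := eqVneq h 0; first by rewrite addr0 subrr !normr0 mulr0.
have Ah : A (z + h) by apply: zA; lra.
have [q [L fq]] := fT _ Ah.
have [_ gq] := touched_diff oA cf Ah fq.
have sq := touched_subgrad oA (@subset_refl _ _) cf Ah fq.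
have sz := touched_subgrad oA (@subset_refl _ _) cf Az ft.
rewrite gz gq.
apply: norm_le_coord => [|i]; first by rewrite !mulr_ge0.
(* Testing with w = s |h| e_i and s = 1, -1 bounds the i-th coordinate. *)
have key (s : R) : `|s| = 1 -> s * (q - p) 0 i * `|h| <= 4 * K * `|h| ^+ 2.
  move=> s1; pose w := (s * `|h|) *: (delta_mx 0 i : 'rV[R]_m).
  have wn : `|w| <= `|h|.
    apply: norm_le_coord => // j; rewrite !mxE eqxx /= normrM normrM s1 mul1r normr_id.
    by case: (j == i); rewrite ?normr1 ?mulr1 // normr0 mulr0.
  have hw : `|h + w| <= 2 * `|h| by apply: le_trans (ler_normD _ _) _; lra.
  have Ahw : A (z + (h + w)) by apply: zA; lra.
  have fhw : `|h + w| < e by lra.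
  have := sq _ Ahw; rewrite addrA [_ + h + w - _]addrC addKr.
  have := fe _ fhw; rewrite addrA.
  have := sz _ Ah; rewrite [z + h - z]addrC addKr.
  rewrite dotDr => F1 F2 F3.
  have F4 : K * `|h + w| ^+ 2 <= K * (4 * `|h| ^+ 2).
    rewrite ler_wpM2l //; apply: le_trans (_ : (2 * `|h|) ^+ 2 <= _).
      by rewrite lerXn2r // nnegrE // mulr_ge0.
    by rewrite exprMn; lra.
  have : dot (q - p) w = s * (q - p) 0 i * `|h|.
    by rewrite /w dotZr dot_delta; ring.
  rewrite dotBl => <-; lra.
have hpos : 0 < `|h| by rewrite normr_gt0.
have k1 := key 1 (normr1 _).
have k2 := key (-1) (normrN1 _).
rewrite ler_norml -[_ <= _ * _](ler_pM2r hpos) -[- _ <= _](ler_pM2r hpos); nra.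
Qed.

End ConvexTouched.

(** * Lipschitz gradients along segments and at boundary points *)
Section Lip.
Context {R : realType}.

(** Continuous induction: the supremum of the s for which the bound holds up to s
    satisfies it too, and it could be increased if it were less than 1. *)
Lemma lipschitz_of_local (F : R -> R) (L : R) : 0 <= L ->
  (forall s, 0 <= s <= 1 -> exists2 e : R, 0 < e & forall s', 0 <= s' <= 1 ->
     `|s' - s| < e -> `|F s' - F s| <= L * `|s' - s|) ->
  `|F 1 - F 0| <= L.
Proof.
move=> L0 loc; pose S := [set s | 0 <= s <= 1 /\ `|F s - F 0| <= L * s].
have S0 : S 0 by split; [rewrite lexx ler01|rewrite subrr normr0 mulr0].
have Sub : ubound S 1 by move=> s [/andP[]].
have hS : has_sup S by split; [exists 0|exists 1].
pose c := sup S.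
have c1 : c <= 1 by apply: ge_sup => //; exists 0.
have c0 : 0 <= c by apply: ub_le_sup => //; exists 1.
have [e e0 ce] := loc c (introT andP (conj c0 c1)).
have Sc : S c.
  split; first by rewrite c0.
  have [s Ss sc] := sup_adherent e0 hS.
  have sc' : s <= c by apply: ub_le_sup => //; exists 1.
  have [s01 Fs] := Ss.
  have E : `|s - c| = c - s by rewrite distrC ger0_norm ?subr_ge0.
  have h1 : c - s < e by rewrite /c; lra.
  have := ce s s01; rewrite E => /(_ h1).
  rewrite !ler_norml => /andP[? ?]; move: Fs; rewrite ler_norml => /andP[? ?].
  apply/andP; split; nra.
have [c_eq|c_lt] : c = 1 \/ c < 1.
  by move: c1; rewrite le_eqVlt => /orP[/eqP|]; [left|right].
  by move: Sc.2; rewrite c_eq mulr1.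
pose s := Num.min (c + e / 2) 1.
have cs : c < s by rewrite lt_min c_lt andbT; lra.
have se : s <= c + e / 2 by rewrite ge_min lexx.
have s1 : s <= 1 by rewrite ge_min lexx orbT.
suff : S s by move=> /(ub_le_sup (ex_intro _ 1 Sub)); rewrite -/c; lra.
split; first by apply/andP; split; lra.
have s01 : 0 <= s <= 1 by apply/andP; split; lra.
have E : `|s - c| = s - c by rewrite gtr0_norm ?subr_gt0.
have := ce s s01; rewrite E => /(_ ltac:(lra)).
move: Sc.2; rewrite !ler_norml => /andP[? ?] /andP[? ?].
apply/andP; split; nra.
Qed.

Context {m : nat}.
Implicit Types (p q h x y z w : 'rV[R]_m) (f : 'rV[R]_m -> R) (A : set 'rV[R]_m).

(** The pointwise estimate [touched_grad_near] has a constant independent of the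
    point, so it accumulates along the segment without loss. *)
Lemma grad_lipschitz_segment A f z1 z2 K : open A -> convex_on A f -> 0 <= K ->
  (forall w, A w -> exists q L, touched f w q L) ->
  (forall s : R, 0 <= s <= 1 -> A (z1 + s *: (z2 - z1)) /\
     exists q, touched f (z1 + s *: (z2 - z1)) q K) ->
  `|grad f z2 - grad f z1| <= 4 * K * `|z2 - z1|.
Proof.
move=> oA cf K0 fT seg.
have L0 : 0 <= 4 * K * `|z2 - z1| by rewrite !mulr_ge0.
apply: norm_le_coord => // i.
have := @lipschitz_of_local (fun s => grad f (z1 + s *: (z2 - z1)) 0 i) _ L0.
rewrite scale1r scale0r addr0 [z1 + _]addrC subrK !mxE; apply.
move=> s s01; have [As [q fq]] := seg s s01.
have [e e0 He] := touched_grad_near oA cf As fT fq K0.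
have N0 : 0 < `|z2 - z1| + 1 by rewrite ltr_wpDl.
exists (e / (`|z2 - z1| + 1)); first by rewrite divr_gt0.
move=> s' s'01; rewrite ltr_pdivlMr // => se.
have E : z1 + s' *: (z2 - z1) = z1 + s *: (z2 - z1) + (s' - s) *: (z2 - z1).
  by rewrite -addrA -scalerDl; congr (_ + _ *: _); ring.
have he : `|(s' - s) *: (z2 - z1)| < e.
  by rewrite normrZ; apply: le_lt_trans se; rewrite ler_wpM2l // lerDl.
have := He _ he; rewrite -E normrZ => H.
have := le_trans (coord_le_norm _ i) H; rewrite !mxE => /le_trans; apply.
by rewrite mulrCA mulrC.
Qed.

Lemma closure_approx A z (e : R) : closure A z -> 0 < e ->
  exists2 y, A y & `|y - z| < e.
Proof.
move=> clz e0; have [y [Ay zy]] := clz _ (nbhsx_ballx z _ e0).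
by exists y => //; move: zy; rewrite -ball_normE /= distrC.
Qed.

(** Values of G near z form a Cauchy filter. *)
Lemma cvg_of_lipschitz A (G : 'rV[R]_m -> 'rV[R]_m) z (L e : R) : closure A z ->
  0 < e ->
  (forall y1 y2, A y1 -> A y2 -> `|y1 - z| < e -> `|y2 - z| < e ->
     `|G y1 - G y2| <= L * `|y1 - y2|) ->
  cvg (G y @[y --> within A (nbhs z)]).
Proof.
move=> clz e0 GL.
have PF : ProperFilter (within A (nbhs z)) by exact: within_nbhs_proper.
apply/cauchy_cvgP/cauchy_exP => r /= r0.
have L1 : 0 < `|L| + 1 by rewrite ltr_wpDl.
pose d := Num.min e (r / (`|L| + 1) / 2).
have d0 : 0 < d by rewrite lt_min e0 !divr_gt0.
have de : d <= e by rewrite ge_min lexx.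
have dr : (`|L| + 1) * (d * 2) <= r.
  by rewrite mulrC -ler_pdivlMr // -ler_pdivlMr // ge_min lexx orbT.
have [y Ay yz] := closure_approx clz d0.
exists (G y); apply/nbhs_ballP; exists d => //= y' y'z Ay'.
rewrite -ball_normE /=.
have y'z' : `|y' - z| < d by move: y'z; rewrite -ball_normE /= distrC.
have H : `|G y - G y'| <= L * `|y - y'| by apply: GL => //; lra.
apply: (le_lt_trans H).
have yy' : `|y - y'| < d * 2.
  have -> : y - y' = (y - z) - (y' - z) by rewrite opprB addrA subrK.
  apply: le_lt_trans (ler_normB _ _) _; lra.
apply: (@le_lt_trans _ _ ((`|L| + 1) * `|y - y'|)).
  by rewrite ler_wpM2r // (le_trans (ler_norm _)) // lerDl.
by apply: lt_le_trans dr; rewrite ltr_pM2l.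
Qed.

Lemma lim_approx A (G : 'rV[R]_m -> 'rV[R]_m) z (e : R) : closure A z ->
  cvg (G y @[y --> within A (nbhs z)]) -> 0 < e ->
  exists y, [/\ A y, `|y - z| < e &
   `|G y - lim (G y @[y --> within A (nbhs z)])| < e].
Proof.
move=> clz cG e0.
have PF : ProperFilter (within A (nbhs z)) by exact: within_nbhs_proper.
have /cvgrPdist_lt/(_ _ e0) := cG.
rewrite near_withinE => /nbhs_ballP[d /= d0 H].
have de0 : 0 < Num.min d e by rewrite lt_min d0.
have [y Ay] := closure_approx clz de0; rewrite lt_min => /andP[yd ye].
exists y; split => //; rewrite distrC; apply: H => //.
by rewrite -ball_normE /= distrC.
Qed.
End Lip.

(** * Outer Lebesgue measure of a box *)
Section OuterMeasure.
Context {R : realType}.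

(** Induction on the dimension m.  For a fixed last coordinate y, the slices of the
    boxes whose last side contains y cover the slice of the box; the induction
    hypothesis is integrated in y, and sum and integral are exchanged.  The
    weights c let the induction hypothesis select those boxes. *)
Lemma volume_le_cover (m : nat) (a b : nat -> R) (A B : nat -> nat -> R)
  (c : nat -> R) :
  (forall i, a i <= b i) -> (forall k i, A k i <= B k i) ->
  (forall k, 0 <= c k) ->
  (forall x : nat -> R, (forall i, (i < m)%N -> a i <= x i <= b i) ->
     exists k, 1 <= c k /\ forall i, (i < m)%N -> A k i <= x i <= B k i) ->
  ((\prod_(i < m) (b i - a i))%:E <=
   \sum_(k <oo) (c k * \prod_(i < m) (B k i - A k i))%:E)%E.
Proof.
elim: m c => [|m IH] c ab AB c0 cov.
  have [k [ck _]] := cov a (fun=> ltac:(by [])).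
  have f0 i : (0 <= (c i * \prod_(j < 0) (B i j - A i j))%:E)%E.
    by rewrite big_ord0 mulr1 lee_fin.
  rewrite big_ord0; apply: le_trans (nneseries_lim_ge k.+1 (fun i _ _ => f0 i)).
  rewrite big_nat_recr //= big_ord0 mulr1.
  apply: (@le_trans _ _ (c k)%:E); first by rewrite lee_fin.
  by rewrite leeDr // sume_ge0.
pose W k := \prod_(i < m) (B k i - A k i).
pose V := \prod_(i < m) (b i - a i).
have W0 k : 0 <= W k by rewrite prodr_ge0 // => i _; rewrite subr_ge0.
have V0 : 0 <= V by rewrite prodr_ge0 // => i _; rewrite subr_ge0.
pose D : set R := `[a m, b m]%classic.
pose I k : set R := `[A k m, B k m]%classic.
have mD : measurable D by exact: measurable_itv.
have mI k : measurable (I k) by exact: measurable_itv.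
have slice y : D y -> (V%:E <= \sum_(k <oo) (c k * W k)%:E * (\1_(I k) y)%:E)%E.
  move=> Dy.
  have := IH (fun k => c k * \1_(I k) y) ab AB.
  rewrite (eq_eseriesr (g := fun k => ((c k * W k)%:E * (\1_(I k) y)%:E)%E)); last first.
    by move=> k _; rewrite -EFinM mulrAC.
  apply; first by move=> k; rewrite mulr_ge0.
  move=> x xab.
  have [|k [ck xk]] := cov (fun i => if (i < m)%N then x i else y).
    move=> i; rewrite ltnS leq_eqVlt => /orP[/eqP ->|im].
      by rewrite ltnn; move: Dy; rewrite /D /= in_itv.
    by rewrite im; apply: xab.
  exists k; split; last first.
    by move=> i im; have := xk i (ltnW im); rewrite im; apply.
  have := xk m (ltnSn m); rewrite ltnn => yk.
  by rewrite indicE mem_set ?mulr1 // /I /= in_itv.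
have len (p q : R) : p <= q -> lebesgue_measure (`[p, q]%classic : set R) = (q - p)%:E.
  rewrite le_eqVlt => /orP[/eqP ->|pq].
    by rewrite lebesgue_measure_itv /= ltxx subrr.
  by rewrite lebesgue_measure_itv /= lte_fin pq.
have pos k y : (0 <= (c k * W k)%:E * (\1_(I k) y)%:E)%E.
  by rewrite -EFinM lee_fin !mulr_ge0.
have mind k : measurable_fun D (fun y => (\1_(I k) y)%:E).
  by apply/measurable_EFinP; exact: measurable_indic.
have mf k : measurable_fun D (fun y => ((c k * W k)%:E * (\1_(I k) y)%:E)%E).
  by apply: measurable_funeM; exact: mind.
have := @ge0_le_integral _ _ _ (@lebesgue_measure R) D mD (cst V%:E)
  (fun y => \sum_(k <oo) (c k * W k)%:E * (\1_(I k) y)%:E)%E.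
rewrite integral_cst // integral_nneseries //.
move=> H; rewrite big_ord_recr /= -/V EFinM -len //.
apply: le_trans (H _ _ _ _) _.
- by move=> y _ /=; rewrite lee_fin.
- exact: measurable_cst.
- apply: ge0_emeasurable_sum => [k x _ _|k _]; [exact: pos|exact: mf].
- exact: slice.
apply: lee_nneseries => [k _ _|k _].
  by apply: integral_ge0 => y _; exact: pos.
rewrite ge0_integralZl_EFin //; last 2 first.
- exact: mind.
- exact: mulr_ge0.
rewrite [X in (_ * X <= _)%E](_ : _ = lebesgue_measure (I k `&` D)); last exact: (integral_indic (@lebesgue_measure R) mD (mI k)).
rewrite big_ord_recr /= -/(W k) mulrA [leRHS]EFinM.
rewrite lee_wpmul2l ?lee_fin ?mulr_ge0 // -len //.
by apply: le_measure; rewrite ?inE; [exact: (measurableI _ _ (mI k) mD)|exact: mI|].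
Qed.

Lemma lebesgue_outer_gt0 (m : nat) (E : set 'rV[R]_m) (q : 'rV[R]_m) (r : R) :
  0 < r -> (forall p, `|p - q| <= r -> E p) -> (0 < lebesgue_outer E)%E.
Proof.
move=> r0 qE; apply: (@lt_le_trans _ _ ((2 * r) ^+ m)%:E).
  by rewrite lte_fin exprn_gt0 // mulr_gt0.
apply: le_ereal_inf_tmp => _ [a [b [ab Eab ->]]].
(* The default value 0 keeps the sides ordered in the coordinates beyond m. *)
pose ext (v : 'rV[R]_m) (i : nat) : R := if insub i is Some j then v 0 j else 0.
have extE v (j : 'I_m) : ext v j = v 0 j by rewrite /ext valK.
have := @volume_le_cover m (fun i => ext q i - r) (fun i => ext q i + r)
  (fun k => ext (a k)) (fun k => ext (b k)) (fun=> 1).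
rewrite (eq_bigr (fun=> 2 * r)) => [|i _]; last by ring.
rewrite prodr_const card_ord => H; apply: le_trans (H _ _ _ _) _ => // {H}.
- by move=> i; rewrite lerD2l ge0_cp ?ltW.
- by move=> k i; rewrite /ext; case: insubP.
- move=> x xq; pose v : 'rV[R]_m := \row_i x i.
  have /Eab[k _ /= vk] : E v.
    apply: qE; apply: norm_le_coord => [|i]; first exact: ltW.
    have := xq i (ltn_ord i); rewrite extE !mxE ler_norml.
    by move=> /andP[? ?]; apply/andP; split; lra.
  exists k; split => // i im; have := vk (Ordinal im).
  by rewrite mxE -!extE.
apply: lee_nneseries => [k _ _|k _]; rewrite lee_fin mul1r.
  by rewrite prodr_ge0 // => i _; rewrite !extE subr_ge0.
by rewrite (eq_bigr (fun i : 'I_m => b k 0 i - a k 0 i)) // => i _; rewrite !extE.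
Qed.

End OuterMeasure.

(** * Second-order bounds for smooth functions *)
Section Smooth.
Context {R : realType} {n : nat}.
Implicit Types (x y z h : 'rV[R]_n) (f : 'rV[R]_n -> R) (U : set 'rV[R]_n).

(** A limit at z makes f bounded near z, and finitely many such neighbourhoods
    cover the compact closure. *)
Lemma bounded_of_cvg_closure U f : compact (closure U) ->
  (forall z, closure U z -> cvg (f y @[y --> within U (nbhs z)])) ->
  exists M : R, forall x, U x -> `|f x| <= M.
Proof.
move=> /compact_near_coveringP cU cf.
have : \forall M \near +oo%R, closure U `<=` (fun x => U x -> `|f x| <= M).
  apply: (cU R (pinfty_nbhs R) (fun M x => U x -> `|f x| <= M)) => z clz.
  have PF : ProperFilter (within U (nbhs z)) by exact: within_nbhs_proper.
  have /cvgrPdist_lt/(_ _ ltr01) := cf z clz.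
  set l := lim _; rewrite near_withinE => H.
  near=> x M => /= Ux.
  have /= H1 : `|l - f x| < 1 by move: Ux; near: x.
  have H2 : `|l| + 1 <= M by near: M; apply: nbhs_pinfty_ge; rewrite num_real.
  have -> : f x = l - (l - f x) by rewrite subKr.
  by rewrite (le_trans (ler_normB _ _)) // (le_trans _ H2) // lerD2l ltW.
move=> /filter_ex[M HM]; exists M => x Ux; exact: HM (subset_closure Ux) Ux.
Unshelve. all: by end_near. Qed.

Lemma MVT_segment_dot f x h :
  (forall s : R, 0 <= s <= 1 -> differentiable f (x + s *: h)) ->
  exists2 c : R, 0 < c < 1 & f (x + h) - f x = dot (grad f (x + c *: h)) h.
Proof.
move=> df; pose g (s : R) := f (x + s *: h).
have gD (s : R) : 0 <= s <= 1 ->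
    is_derive s 1 g (dot (grad f (x + s *: h)) h).
  move=> /df dfs; have dd : is_derive (x + s *: h) h f (dot (grad f (x + s *: h)) h).
    by apply: DeriveDef; [exact: diff_derivable|exact: derive_dot].
  have E : (fun t => t^-1 *: ((g \o shift s) (t *: 1) - g s)) =
      (fun t => t^-1 *: ((f \o shift (x + s *: h)) (t *: h) - f (x + s *: h))).
    apply/funext => t /=; rewrite /g /=; congr (_ *: (f _ - _)).
    by rewrite scaler1 scalerDl addrCA.
  by case: dd => d1 d2; split; [rewrite /derivable E|rewrite /derive E].
have gI (s : R) : s \in `]0, 1[ -> is_derive s 1 g (dot (grad f (x + s *: h)) h).
  by rewrite in_itv /= => /andP[? ?]; apply/gD/andP; split; exact: ltW.
have gC : {within `[0, 1], continuous g}.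
  apply: derivable_within_continuous => s; rewrite in_itv /= => s01.
  by have [] := gD s s01.
have [c] := MVT ltr01 gI gC.
rewrite in_itv /= => c01; rewrite /g scale1r scale0r addr0 subr0 mulr1 => E.
by exists c.
Qed.

Lemma segment_in U x y (s : R) : convex_dom U -> U x -> U y -> 0 <= s <= 1 -> U (x + s *: (y - x)).
Proof.
move=> cU Ux Uy s01.
have -> : x + s *: (y - x) = s *: y + (1 - s) *: x.
  by apply/rowP => i; rewrite !mxE; ring.
exact: cU.
Qed.

Lemma lipschitz_of_pderiv U f (M : R) : convex_dom U -> 0 <= M -> (forall z, U z -> differentiable f z) ->
  (forall i z, U z -> `|pderiv i f z| <= M) ->
  forall x y, U x -> U y -> `|f y - f x| <= n%:R * M * `|y - x|.
Proof.
move=> cU M0 df fM x y Ux Uy.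
have [s s01|c /andP[c0 c1]] := @MVT_segment_dot f x (y - x).
  by apply: df; exact: segment_in.
have Uc : U (x + c *: (y - x)) by apply: segment_in => //; rewrite !ltW.
have -> : x + (y - x) = y by rewrite addrC subrK.
move=> ->.
apply: dot_le => //; apply: norm_le_coord => // i.
by rewrite mxE fM.
Qed.

(** The mean value theorem twice: for v along the segment, and for each partial
    derivative between x and the intermediate point. *)
Lemma taylor_upper U v (M : R) : convex_dom U -> 0 <= M -> smooth_on U v ->
  (forall i j z, U z -> `|pderivs [:: i; j] v z| <= M) ->
  forall x y, U x -> U y ->
    v y <= v x + dot (grad v x) (y - x) + n%:R ^+ 2 * M * `|y - x| ^+ 2.
Proof.
move=> cU M0 sv vM x y Ux Uy.
have dv z : U z -> differentiable v z by exact: (sv [::]).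
have [s s01|c /andP[c0 c1]] := @MVT_segment_dot v x (y - x).
  by apply: dv; exact: segment_in.
have Uc : U (x + c *: (y - x)) by apply: segment_in => //; rewrite !ltW.
have -> : x + (y - x) = y by rewrite addrC subrK.
move=> E.
have gM : `|grad v (x + c *: (y - x)) - grad v x| <= n%:R * M * `|y - x|.
  apply: norm_le_coord => [|i]; first by rewrite !mulr_ge0.
  have vi j z : U z -> `|pderiv j (pderiv i v) z| <= M by exact: (vM j i).
  rewrite !mxE; apply: le_trans (lipschitz_of_pderiv cU M0 (sv [:: i]) vi Ux Uc) _.
  rewrite addrC addKr normrZ gtr0_norm // ler_wpM2l ?mulr_ge0 //.
  by rewrite ler_piMl // ltW.
have := dot_le gM (lexx `|y - x|); rewrite dotBl -E ler_norml => /andP[_].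
have -> : n%:R * (n%:R * M * `|y - x|) * `|y - x| = n%:R ^+ 2 * M * `|y - x| ^+ 2.
  by ring.
lra.
Qed.

End Smooth.

(** * The space-time cylinder *)
Section Points.
Context {R : realType} {n : nat}.
Implicit Types (x y : 'rV[R]_n) (z w : 'rV[R]_(n + 1)) (s t : R).

Definition xpart z : 'rV[R]_n := lsubmx z.
Definition tpart z : R := (rsubmx z) 0 0.

Lemma pt_eta z : pt (xpart z) (tpart z) = z.
Proof.
rewrite /pt /xpart /tpart -[RHS]hsubmxK; congr row_mx.
by apply/rowP => i; rewrite !mxE !ord1 eqxx mulr1n.
Qed.

Lemma ptK x t : xpart (pt x t) = x /\ tpart (pt x t) = t.
Proof.
by rewrite /xpart /tpart /pt row_mxKl row_mxKr !mxE eqxx.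
Qed.
Lemma xpart_pt x t : xpart (pt x t) = x. Proof. exact: (ptK x t).1. Qed.
Lemma tpart_pt x t : tpart (pt x t) = t. Proof. exact: (ptK x t).2. Qed.

Lemma ptD x y s t : pt x s + pt y t = pt (x + y) (s + t).
Proof. by rewrite /pt add_row_mx raddfD. Qed.
Lemma ptN x t : - pt x t = pt (- x) (- t).
Proof. by rewrite /pt opp_row_mx raddfN. Qed.
Lemma ptZ x s t : s *: pt x t = pt (s *: x) (s * t).
Proof. by rewrite /pt scale_row_mx scale_scalar_mx. Qed.
Lemma ptB x y s t : pt x s - pt y t = pt (x - y) (s - t).
Proof. by rewrite ptN ptD. Qed.

Lemma norm_pt_le x t (c : R) : `|x| <= c -> `|t| <= c -> `|pt x t| <= c.
Proof.
move=> xc tc; apply: norm_le_coord => [|i]; first exact: le_trans xc.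
rewrite /pt mxE; case: splitP => j _.
  exact: le_trans (coord_le_norm _ _) xc.
by rewrite !ord1 mxE eqxx mulr1n.
Qed.

Lemma norm_xpart_le z : `|xpart z| <= `|z|.
Proof.
apply: norm_le_coord => // i; rewrite mxE; exact: coord_le_norm.
Qed.

Lemma norm_tpart_le z : `|tpart z| <= `|z|.
Proof. by rewrite /tpart mxE; exact: coord_le_norm. Qed.

Lemma dot_pt x y s t : dot (pt x s) (pt y t) = dot x y + s * t.
Proof.
rewrite /dot big_split_ord /= big_ord1 /pt; congr (_ + _).
  by apply: eq_bigr => i _; rewrite !row_mxEl.
by rewrite !row_mxEr !mxE eqxx !mulr1n.
Qed.

Lemma xpartD z w : xpart (z + w) = xpart z + xpart w.
Proof. by rewrite /xpart linearD. Qed.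
Lemma tpartD z w : tpart (z + w) = tpart z + tpart w.
Proof. by rewrite /tpart linearD mxE. Qed.
Lemma xpartZ s z : xpart (s *: z) = s *: xpart z.
Proof. by rewrite /xpart linearZ. Qed.
Lemma tpartZ s z : tpart (s *: z) = s * tpart z.
Proof. by rewrite /tpart linearZ mxE. Qed.
Lemma xpartB z w : xpart (z - w) = xpart z - xpart w.
Proof. by rewrite /xpart linearB. Qed.
Lemma tpartB z w : tpart (z - w) = tpart z - tpart w.
Proof. by rewrite /tpart linearB !mxE. Qed.

Lemma cylinderP (U : set 'rV[R]_n) (J : set R) z :
  cylinder U J z <-> U (xpart z) /\ J (tpart z).
Proof.
split=> [[[x t] [/= Ux Jt] <-]|[Uz Jz]]; first by rewrite xpart_pt tpart_pt.
by exists (xpart z, tpart z) => //=; rewrite pt_eta.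
Qed.

End Points.

Section Closure.
Context {R : realType} {m : nat}.
Implicit Types (z y : 'rV[R]_m) (A : set 'rV[R]_m).

Lemma closure_of_approx A z : (forall e : R, 0 < e -> exists2 y, A y & `|y - z| < e) ->
  closure A z.
Proof.
move=> H N /nbhs_ballP[e /= e0 eN]; have [y Ay ye] := H e e0.
by exists y; split => //; apply: eN; rewrite -ball_normE /= distrC.
Qed.

Lemma closure_closure A : closure (closure A) = closure A.
Proof. by apply/esym/closure_id; exact: closed_closure. Qed.

Lemma open_of_ball A : (forall z, A z -> exists2 e : R, 0 < e & forall h, `|h| < e -> A (z + h)) ->
  open A.
Proof.
move=> H; rewrite openE => z Az; have [e e0 He] := H z Az.
apply/nbhs_ballP; exists e => //= y; rewrite -ball_normE /= => zy.
by rewrite -[y](subrK z) addrC; apply: He; rewrite distrC.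
Qed.

(** The form of convexity that an open convex set keeps up to its boundary: the
    segment from an inner point to a boundary point stays inside except for its end. *)
Definition starlike A := forall x y (s : R), A x -> closure A y -> 0 < s <= 1 ->
  A (s *: x + (1 - s) *: y).

Lemma segment_near x y (e : R) : 0 < e ->
  exists2 d : R, 0 < d <= 1 & forall s, 0 < s -> s <= d ->
    `|s *: x + (1 - s) *: y - y| < e.
Proof.
move=> e0; have N0 : 0 < `|x - y| + 1 by rewrite ltr_wpDl.
exists (Num.min 1 (e / (`|x - y| + 1) / 2)).
  by rewrite ge_min lexx andbT lt_min ltr01 !divr_gt0.
move=> s s0; rewrite le_min => /andP[s1].
rewrite ler_pdivlMr // ler_pdivlMr // => sd.
have -> : s *: x + (1 - s) *: y - y = s *: (x - y).
  by apply/rowP => i; rewrite !mxE; ring.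
rewrite normrZ gtr0_norm //.
have : s * `|x - y| <= s * (`|x - y| + 1) by rewrite ler_pM2l // lerDl.
nra.
Qed.

End Closure.

Section Domain.
Context {R : realType} {n : nat}.
Variable U : set 'rV[R]_n.
Hypothesis hU : smooth_strictly_convex_domain U.
Implicit Types (x y : 'rV[R]_n) (z w : 'rV[R]_(n + 1)) (s t : R).

Let oU : open U. Proof. by case: hU => -[]. Qed.
Let sU : strictly_convex U. Proof. by case: hU => _ []. Qed.

Lemma domain_open : open U. Proof. exact: oU. Qed.
Lemma domain_nonempty : U !=set0. Proof. by case: hU => -[]. Qed.

Lemma interior_domain : U° = U.
Proof. by apply/interior_id. Qed.

Lemma bdryE x : bdry U x <-> closure U x /\ ~ U x.
Proof. by rewrite /bdry interior_domain. Qed.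

Lemma convex_comb_id m (x : 'rV[R]_m) s : s *: x + (1 - s) *: x = x.
Proof. by rewrite -scalerDl addrC subrK scale1r. Qed.

Lemma domain_starlike : starlike U.
Proof.
move=> x y s Ux cy /andP[s0]; rewrite le_eqVlt => /orP[/eqP ->|s1].
  by rewrite scale1r subrr scale0r addr0.
have [<-|xy] := eqVneq x y; first by rewrite convex_comb_id.
by rewrite -interior_domain; apply: sU => //; [exact: subset_closure|rewrite s0].
Qed.

Lemma closure_domain_convex : convex_dom (closure U).
Proof.
move=> x y s cx cy /andP[s0 s1].
have [<-|xy] := eqVneq x y; first by rewrite convex_comb_id.
move: s0; rewrite le_eqVlt => /orP[/eqP <-|s0].
  by rewrite scale0r add0r subr0 scale1r.
move: s1; rewrite le_eqVlt => /orP[/eqP ->|s1].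
  by rewrite scale1r subrr scale0r addr0.
apply: subset_closure; rewrite -interior_domain; apply: sU => //.
by rewrite s0.
Qed.

Lemma domain_convex : convex_dom U.
Proof.
move=> x y s Ux Uy /andP[s0 s1].
move: s0; rewrite le_eqVlt => /orP[/eqP <-|s0].
  by rewrite scale0r add0r subr0 scale1r.
by apply: domain_starlike => //; [exact: subset_closure|rewrite s0].
Qed.

Lemma closure_domain_bounded :
  exists2 D : R, 0 < D & forall x, closure U x -> `|x| <= D.
Proof.
have [_ [bU _ _]] := hU.
have [M0 [_ HM]] := bU.
have M1 : M0 < `|M0| + 1 by rewrite (le_lt_trans (ler_norm _)) // ltrDl.
exists (`|M0| + 2); first by rewrite ltr_wpDl.
move=> x clx; have [y Uy yx] := closure_approx clx ltr01.
have /= yM := HM _ M1 y Uy.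
rewrite -(subrK y x); apply: le_trans (ler_normD _ _) _.
by rewrite distrC; lra.
Qed.

Lemma closure_domain_compact : compact (closure U).
Proof.
apply: bounded_closed_compact; last exact: closed_closure.
have [D D0 HD] := closure_domain_bounded.
exists D; split; first by rewrite num_real.
by move=> M DM x /HD /le_trans; apply; exact: ltW.
Qed.

Definition opencyl := cylinder U `]0, 1[.

Lemma opencylP z : opencyl z <-> U (xpart z) /\ 0 < tpart z < 1.
Proof. by rewrite /opencyl cylinderP /= in_itv. Qed.

Lemma opencyl_open : open opencyl.
Proof.
apply: open_of_ball => z /opencylP[Uz /andP[z0 z1]].
have [e e0 He] := open_ball oU Uz.
exists (Num.min e (Num.min (tpart z) (1 - tpart z))).
  by rewrite !lt_min e0 z0 subr_gt0.
move=> h; rewrite !lt_min => /and3P[h1 h2 h3].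
apply/opencylP; rewrite xpartD tpartD; split.
  by apply: He; apply: le_lt_trans h1; exact: norm_xpart_le.
have := norm_tpart_le h; rewrite ler_norml => /andP[? ?].
by apply/andP; split; lra.
Qed.

Lemma closure_opencylP z : closure opencyl z <-> closure U (xpart z) /\ 0 <= tpart z <= 1.
Proof.
split=> [cz|[cz /andP[z0 z1]]].
  split.
    apply: closure_of_approx => e e0; have [y /opencylP[Uy _] ye] := closure_approx cz e0.
    exists (xpart y) => //; rewrite -xpartB; exact: le_lt_trans (norm_xpart_le _) ye.
  have H (e : R) : 0 < e -> - e < tpart z < 1 + e.
    move=> e0; have [y /opencylP[_ /andP[y0 y1]] ye] := closure_approx cz e0.
    have := le_lt_trans (norm_tpart_le _) ye; rewrite tpartB ltr_norml => /andP[? ?].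
    by apply/andP; split; lra.
  rewrite !leNgt; apply/andP; split; apply/negP => zt.
    by have /andP[] := H (- tpart z / 2) ltac:(lra); lra.
  by have /andP[] := H ((tpart z - 1) / 2) ltac:(lra); lra.
have [x0 Ux0] := domain_nonempty.
apply: closure_of_approx => e e0.
have [d /andP[d0 d1] Hd] := segment_near (pt x0 2^-1) z e0.
exists (d *: pt x0 2^-1 + (1 - d) *: z); last exact: Hd.
apply/opencylP; rewrite xpartD tpartD !xpartZ !tpartZ xpart_pt tpart_pt; split.
  by apply: domain_starlike => //; rewrite d0.
by apply/andP; split; nra.
Qed.

Lemma opencyl_starlike : starlike opencyl.
Proof.
move=> x y s /opencylP[Ux /andP[x0 x1]] /closure_opencylP[cy /andP[y0 y1]] /andP[s0 s1].
apply/opencylP; rewrite xpartD tpartD !xpartZ !tpartZ; split.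
  by apply: domain_starlike => //; rewrite s0.
by apply/andP; split; nra.
Qed.

Lemma closure_cylinder01 : closure (cylinder U `[0, 1]) = closure opencyl.
Proof.
apply/seteqP; split; last first.
  apply: closureS => z /opencylP[Uz /andP[z0 z1]]; apply/cylinderP; split => //=.
  by rewrite in_itv /= !ltW.
rewrite -[X in _ `<=` X]closure_closure.
apply: closureS => z /cylinderP[Uz]; rewrite /= in_itv /= => zt.
by apply/closure_opencylP; split => //; exact: subset_closure.
Qed.

Lemma closure_opencyl_compact : compact (closure opencyl).
Proof.
apply: bounded_closed_compact; last exact: closed_closure.
have [D D0 HD] := closure_domain_bounded.
exists (D + 1); split; first by rewrite num_real.
move=> M DM z /closure_opencylP[/HD zD /andP[z0 z1]].
rewrite -(pt_eta z); apply: norm_pt_le; first lra.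
by rewrite ger0_norm //; lra.
Qed.

Lemma cornersE z : corners U z <->
  [/\ closure U (xpart z), ~ U (xpart z) & tpart z = 0 \/ tpart z = 1].
Proof.
by rewrite /corners cylinderP bdryE /=; split=> [[[]]|[]].
Qed.

End Domain.

(** * Convexity up to the closure and the Alexandrov comparison *)
Section Continuity.
Context {R : realType} {m : nat}.
Implicit Types (x y z w p q : 'rV[R]_m) (A : set 'rV[R]_m) (u : 'rV[R]_m -> R).

Lemma within_continuousP A u : {within A, continuous u} <->
  (forall x, A x -> forall e : R, 0 < e -> exists2 d : R, 0 < d &
     forall y, A y -> `|y - x| < d -> `|u y - u x| < e).
Proof.
split=> [/subspace_continuousP uc x Ax e e0|H].
  have /cvgrPdist_lt/(_ _ e0) := uc x Ax.
  rewrite near_withinE => /nbhs_ballP[d /= d0 Hd]; exists d => // y Ay yx.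
  by rewrite distrC; apply: Hd => //; rewrite -ball_normE /= distrC.
apply/subspace_continuousP => x Ax; apply/cvgrPdist_lt => e e0.
have [d d0 Hd] := H x Ax e e0; rewrite near_withinE.
apply/nbhs_ballP; exists d => //= y; rewrite -ball_normE /= => xy Ay.
by rewrite distrC; apply: Hd => //; rewrite distrC.
Qed.

Lemma convex_on_of_function A u : convex_function A u -> convex_on A u.
Proof.
move=> cu x y s Ax Ay /andP[s0 s1].
by have := cu (Itv01 s0 s1) x y (mem_set Ax) (mem_set Ay).
Qed.

(** The whole configuration is shrunk by a small amount towards a point of A, which
    moves it into A, and continuity is used at its three points. *)
Lemma convex_on_closure A u : A !=set0 -> starlike A -> convex_on A u ->
  {within closure A, continuous u} -> convex_on (closure A) u.
Proof.
move=> [a Aa] stA cu /within_continuousP uc x y s cx cy s01.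
pose L (d : R) w := d *: a + (1 - d) *: w.
have near_u w e : closure A w -> 0 < e ->
    exists2 d : R, 0 < d <= 1 & forall t, 0 < t -> t <= d -> `|u (L t w) - u w| < e.
  move=> cw e0; have [r r0 Hr] := uc w cw e e0.
  have [d /andP[d0 d1] Hd] := segment_near a w r0.
  exists d; first by rewrite d0.
  move=> t t0 td; apply: Hr; last exact: Hd.
  by apply: subset_closure; apply: stA => //; rewrite t0 (le_trans td).
set z := s *: x + (1 - s) *: y.
have LA w t : closure A w -> 0 < t -> t <= 1 -> A (L t w).
  by move=> cw t0 t1; apply: stA => //; rewrite t0.
have Lz t : L t z = s *: L t x + (1 - s) *: L t y.
  by apply/rowP => i; rewrite /L /z !mxE; ring.
have AL t : 0 < t -> t <= 1 -> A (L t z).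
  move=> t0 t1; have Ax := LA _ _ cx t0 t1; have Ay := LA _ _ cy t0 t1.
  rewrite Lz; have /andP[s0 s1] := s01.
  move: s0; rewrite le_eqVlt => /orP[/eqP <-|s0].
    by rewrite scale0r add0r subr0 scale1r.
  by apply: stA => //; [exact: subset_closure|rewrite s0].
have cz : closure A z.
  apply: closure_of_approx => e e0; have [d /andP[d0 d1] Hd] := segment_near a z e0.
  by exists (L d z); [exact: AL|exact: Hd].
apply/ler_addgt0Pr => e e0; have e3 : 0 < e / 3 by rewrite divr_gt0.
have [d1 /andP[d10 d11] H1] := near_u _ _ cx e3.
have [d2 /andP[d20 d21] H2] := near_u _ _ cy e3.
have [d3 /andP[d30 d31] H3] := near_u _ _ cz e3.
pose d := Num.min d1 (Num.min d2 d3).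
have d0 : 0 < d by rewrite !lt_min d10 d20.
have dd1 : d <= d1 by rewrite ge_min lexx.
have dd2 : d <= d2 by rewrite !ge_min lexx orbT.
have dd3 : d <= d3 by rewrite !ge_min lexx !orbT.
have {}H1 := H1 d d0 dd1; have {}H2 := H2 d d0 dd2; have {}H3 := H3 d d0 dd3.
have d_1 : d <= 1 by apply: le_trans d11.
have := cu _ _ s (LA _ _ cx d0 d_1) (LA _ _ cy d0 d_1) s01.
rewrite -Lz; move: H1 H2 H3; rewrite !ltr_norml => /andP[? ?] /andP[? ?] /andP[? ?].
have /andP[? ?] := s01; nra.
Qed.

(** If the affine function exceeded u at z, then for every p close to its slope q
    the minimum of u - p over the compact closure would be attained inside A, where p is
    a subgradient.  The subgradients would then contain a ball around q, which has
    positive measure. *)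
Lemma affine_below_of_MA0 A u q (c : R) : compact (closure A) ->
  {within closure A, continuous u} -> MA_measure A u A = 0%E ->
  (forall w, closure A w -> ~ A w -> dot q w + c <= u w) ->
  forall z, A z -> dot q z + c <= u z.
Proof.
move=> cA uc MA0 bd z Az; rewrite leNgt; apply/negP => uz.
pose d := dot q z + c - u z; have d0 : 0 < d by rewrite subr_gt0.
have [D D0 HD] : exists2 D : R, 0 < D & forall w, closure A w -> `|w - z| <= D.
  have [M0 [_ HM]] := compact_bounded cA.
  have M1 : M0 < `|M0| + 1 by rewrite (le_lt_trans (ler_norm _)) // ltrDl.
  exists (`|M0| + 1 + `|z|); first by have := normr_ge0 M0; have := normr_ge0 z; lra.
  move=> w cw; apply: le_trans (ler_normB _ _) _; rewrite lerD2r; exact: HM cw.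
have mD : 0 < m%:R * D + 1 by rewrite ltr_wpDl // mulr_ge0 // ltW.
(* For |p - q| <= r, replacing the slope q by p changes the increments from z by less
   than the gap d. *)
pose r := d / (m%:R * D + 1).
have r0 : 0 < r by rewrite divr_gt0.
have := @lebesgue_outer_gt0 R m (\bigcup_(w in A) subdiff A u w) q r r0.
rewrite -[lebesgue_outer _]/(MA_measure A u A) MA0 ltxx => H; suff : false by [].
apply: H => p pq.
have vc : {within closure A, continuous (fun w => u w - dot p w)}.
  apply/within_continuousP => x cx e e0; have e2 : 0 < e / 2 by rewrite divr_gt0.
  have [d1 d10 H1] := (within_continuousP _ _).1 uc x cx _ e2.
  have /cvgrPdist_lt/(_ _ e2)/nbhs_ballP[d2 /= d20 H2] := @dot_continuous _ _ p x.
  exists (Num.min d1 d2); first by rewrite lt_min d10.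
  move=> y cy; rewrite lt_min => /andP[/(H1 _ cy) h1 yx].
  have h2 : `|dot p x - dot p y| < e / 2 by apply: H2; rewrite -ball_normE /= distrC.
  have -> : u y - dot p y - (u x - dot p x) = (u y - u x) + (dot p x - dot p y) by ring.
  by apply: le_lt_trans (ler_normD _ _) _; lra.
have [w cw wmin] := compact_EVT_min (ex_intro _ z (subset_closure Az)) cA vc.
move: cw; rewrite inE => cw.
have {}wmin y : closure A y -> u w - dot p w <= u y - dot p y.
  by move=> cy; apply: wmin; rewrite inE.
have [Aw|nAw] := pselect (A w).
  exists w => // y Ay; rewrite mulmx_trE dotBr.
  by have := wmin y (subset_closure Ay); lra.
have := bd w cw nAw; have := wmin z (subset_closure Az).
have := dot_le pq (HD w cw); rewrite dotBl !dotBr ler_norml => /andP[_ h1].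
have : m%:R * r * D < d.
  rewrite /r mulrAC mulrCA -[ltRHS]mulr1 ltr_pM2l // ltr_pdivrMr //; lra.
rewrite /d in h1 *; lra.
Qed.

End Continuity.

Section Support.
Context {R : realType} {n : nat}.
Implicit Types (x y : 'rV[R]_n).

(** Moving x1 towards y by t (y - x1) and x0 by the amount that restores the
    constraint cannot decrease the sum; phi changes at first order by its slope p,
    and psi by at most its chord. *)
Lemma common_slope (U C : set 'rV[R]_n) phi psi (a b : R) x0 x1 p K :
  open U -> U `<=` C -> convex_dom C -> convex_on C psi ->
  0 < a -> 0 < b -> U x0 -> C x1 -> touched phi x0 p K ->
  (forall y0 y1, C y0 -> C y1 -> a *: y0 + b *: y1 = a *: x0 + b *: x1 ->
     a * phi x0 + b * psi x1 <= a * phi y0 + b * psi y1) ->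
  forall y, C y -> psi x1 + dot p (y - x1) <= psi y.
Proof.
move=> oU UC cC cpsi a0 b0 Ux0 Cx1 [e1 e10 tp] minx y Cy.
have [e2 e20 He2] := open_ball oU Ux0.
pose h := (b / a) *: (y - x1).
have N0 : 0 < `|h| + 1 by rewrite ltr_wpDl.
rewrite -subr_ge0.
apply: (@ge0_of_small _ _ (a / b * K * `|h| ^+ 2)
  (Num.min 1 (Num.min e1 e2 / (`|h| + 1)))).
  by rewrite lt_min ltr01 divr_gt0 // lt_min e10.
move=> t t0; rewrite lt_min => /andP[t1]; rewrite ltr_pdivlMr // => te.
have hn : `| - (t *: h)| < Num.min e1 e2.
  rewrite normrN normrZ gtr0_norm //; apply: le_lt_trans te.
  by rewrite ler_pM2l // lerDl.
have /andP[h1 h2] : (`| - (t *: h)| < e1) && (`| - (t *: h)| < e2).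
  by rewrite -lt_min.
have Cy0 := UC _ (He2 _ h2).
have t01 : 0 <= t <= 1 by rewrite !ltW.
have Cy1 := cC _ _ _ Cy Cx1 t01.
have := minx _ _ Cy0 Cy1.
have -> : a *: (x0 - t *: h) + b *: (t *: y + (1 - t) *: x1) = a *: x0 + b *: x1.
  by apply/rowP => i; rewrite /h !mxE; field; exact: lt0r_neq0.
move=> /(_ erefl) F1.
have := cpsi _ _ _ Cy Cx1 t01.
rewrite -(ler_pM2l b0) => F2.
have := tp _ h1; rewrite -(ler_pM2l a0) dotNr dotZr normrN normrZ gtr0_norm // exprMn => F3.
have F4 : a * dot p h = b * dot p (y - x1).
  by rewrite /h dotZr; field; exact: lt0r_neq0.
rewrite -(pmulr_rge0 _ (mulr_gt0 t0 b0)).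
have -> : t * b * (psi y - (psi x1 + dot p (y - x1)) + t * (a / b * K * `|h| ^+ 2)) =
   t * (b * psi y - b * psi x1 - b * dot p (y - x1)) + t ^+ 2 * (a * K * `|h| ^+ 2).
  by field; exact: lt0r_neq0.
rewrite -F4; nra.
Qed.

End Support.

(** * The class of boundary data *)
Section ClassS.
Context {R : realType} {n : nat}.
Variable U : set 'rV[R]_n.
Hypothesis hU : smooth_strictly_convex_domain U.
Implicit Types (x y : 'rV[R]_n) (v : 'rV[R]_n -> R).

(** Over a finite family, the sum of the individual bounds serves them all. *)
Lemma uniform_bound (I : finType) (A : set 'rV[R]_n) (f : I -> 'rV[R]_n -> R) :
  (forall i, exists M : R, forall x, A x -> `|f i x| <= M) ->
  exists2 M : R, 0 <= M & forall i x, A x -> `|f i x| <= M.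
Proof.
move=> /choice[M HM]; exists (\sum_i `|M i|); first exact: sumr_ge0.
move=> i x Ax; apply: le_trans (HM i x Ax) _; apply: le_trans (ler_norm _) _.
by rewrite (bigD1 i) //= lerDl sumr_ge0.
Qed.

(** All that the estimates use of the smoothness of a function of the class S: the
    constants below depend on the data through M only. *)
Definition taylor_bounds v (M : R) : Prop :=
  [/\ forall x, closure U x -> `|v x| <= M,
      forall x, U x -> `|grad v x| <= M &
      forall x y, U x -> U y ->
        v y <= v x + dot (grad v x) (y - x) + M * `|y - x| ^+ 2].

Lemma taylor_bounds_le v (M M' : R) : M <= M' ->
  taylor_bounds v M -> taylor_bounds v M'.
Proof.
move=> MM [a1 a2 a3]; split=> [x cx|x Ux|x y Ux Uy].
- exact: le_trans (a1 x cx) MM.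
- exact: le_trans (a2 x Ux) MM.
- by apply: le_trans (a3 x y Ux Uy) _; rewrite lerD2l ler_wpM2r ?exprn_ge0.
Qed.

Lemma class_S_bounds v : class_S U v ->
  exists2 M : R, 0 <= M & taylor_bounds v M.
Proof.
move=> [[cv sv ev] _ _].
have cU := closure_domain_compact hU.
have bd s : exists M : R, forall x, U x -> `|pderivs s v x| <= M.
  by apply: bounded_of_cvg_closure => // z; exact: ev.
have [M1 M10 H1] : exists2 M : R, 0 <= M & forall x, closure U x -> `|v x| <= M.
  have [M0 [_ HM]] := compact_bounded (continuous_compact cv cU).
  have M1 : M0 < `|M0| + 1 by rewrite (le_lt_trans (ler_norm _)) // ltrDl.
  exists (`|M0| + 1); first by rewrite addr_ge0.
  by move=> x cx; apply: (HM _ M1); exists x.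
have [M2 M20 H2] := @uniform_bound _ U (fun i : 'I_n => pderivs [:: i] v) (fun i => bd _).
have [M3 M30 H3] := @uniform_bound _ U (fun ij : 'I_n * 'I_n => pderivs [:: ij.1; ij.2] v)
  (fun i => bd _).
have n2 : 0 <= n%:R ^+ 2 * M3 by rewrite mulr_ge0 // exprn_ge0.
exists (M1 + M2 + n%:R ^+ 2 * M3); first by rewrite !addr_ge0.
split=> [x cx|x Ux|x y Ux Uy].
- by apply: le_trans (H1 x cx) _; lra.
- apply: (@le_trans _ _ M2); last lra.
  by apply: norm_le_coord => // i; rewrite mxE; exact: H2.
- have := taylor_upper (domain_convex hU) M30 sv (fun i j => H3 (i, j)) Ux Uy.
  move=> /le_trans; apply; rewrite lerD2l ler_wpM2r ?exprn_ge0 //; lra.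
Qed.

Lemma grad0_of_locally_constant v (c : R) x : U x -> (forall y, U y -> v y = c) ->
  grad v x = 0.
Proof.
move=> Ux vc; have [e e0 He] := open_ball (domain_open hU) Ux.
apply: (diff_of_quadratic (K := 0) _).2.
apply/nbhs_ballP; exists e => //= h; rewrite -ball_normE /= sub0r normrN => he.
rewrite !vc //; last exact: He.
by rewrite subrr sub0r dotC dot0r oppr0 normr0 mul0r.
Qed.

(** A constant function has zero Hessian, which is not positive definite in positive
    dimension. *)
Lemma class_S_not_constant v (c : R) : (0 < n)%N -> class_S U v ->
  (forall y, U y -> v y = c) -> False.
Proof.
move=> n0 [[cv sv ev] pd _] vc; have [x Ux] := domain_nonempty hU.
have D1 i y : U y -> pderiv i v y = 0.
  by move=> Uy; have := grad0_of_locally_constant Uy vc => /rowP/(_ i); rewrite !mxE.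
have D2 i j y : U y -> pderivs [:: i; j] v y = 0.
  move=> Uy; have := grad0_of_locally_constant Uy (D1 j).
  by move=> /rowP/(_ i); rewrite !mxE.
have cx : closure U x by exact: subset_closure.
have PF : ProperFilter (within U (nbhs x)) by exact: within_nbhs_proper.
have hess0 : hessian_closure U v x = 0.
  apply/matrixP => i j; rewrite !mxE; apply: lim_near_cst => //.
  by rewrite near_withinE; apply: nearW => y Uy; exact: D2.
have := pd x cx (delta_mx 0 (Ordinal n0)).
rewrite hess0 mulmx0 mul0mx mxE ltxx => /(_ _)/notF; apply.
apply/eqP => /rowP/(_ (Ordinal n0)); rewrite !mxE !eqxx => /eqP.
by rewrite oner_eq0.
Qed.

(** A convex function that attains its maximum at an interior point is constant.  The
    maximum is therefore attained on the boundary of U only, where v vanishes. *)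
Lemma class_S_negative v : (0 < n)%N -> class_S U v -> convex_on (closure U) v ->
  forall x, U x -> v x < 0.
Proof.
move=> n0 Sv cv.
(* For any y, the maximum point x lies between y and x + t (x - y). *)
have noint x : U x -> ~ (forall y, closure U y -> v y <= v x).
  move=> Ux mx; apply: (@class_S_not_constant v (v x)) => // y Uy.
  have cy := subset_closure Uy.
  apply/eqP; rewrite eq_le mx //=.
  have [e e0 He] := open_ball (domain_open hU) Ux.
  have N0 : 0 < `|x - y| + 1 by rewrite ltr_wpDl.
  pose t := e / (`|x - y| + 1) / 2.
  have t0 : 0 < t by rewrite !divr_gt0.
  have Uz : U (x + t *: (x - y)).
    apply: He; rewrite normrZ gtr0_norm //.
    apply: (@le_lt_trans _ _ (t * (`|x - y| + 1))).
      by rewrite ler_pM2l // lerDl.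
    by rewrite /t mulrAC divfK ?lt0r_neq0 // ltr_pdivrMr //; lra.
  have t1 : 0 < 1 + t by rewrite addr_gt0.
  have s01 : 0 <= t / (1 + t) <= 1.
    by apply/andP; split; [rewrite divr_ge0 // ltW | rewrite ler_pdivrMr //; lra].
  have := cv y (x + t *: (x - y)) _ cy (subset_closure Uz) s01.
  have -> : t / (1 + t) *: y + (1 - t / (1 + t)) *: (x + t *: (x - y)) = x.
    apply/rowP => i; rewrite !mxE; field; exact: lt0r_neq0.
  have := mx _ (subset_closure Uz).
  rewrite -(ler_pM2r t1 (v x) (_ + _)) => F1.
  have -> : (t / (1 + t) * v y + (1 - t / (1 + t)) * v (x + t *: (x - y))) * (1 + t)
    = t * v y + v (x + t *: (x - y)) by field; exact: lt0r_neq0.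
  by move=> F2; rewrite -(ler_pM2l t0); lra.
have [x0 Ux0] := domain_nonempty hU.
have [[cont _ _] _ v0] := Sv.
have [c cc cmax] := compact_EVT_max (ex_intro _ x0 (subset_closure Ux0))
  (closure_domain_compact hU) cont.
rewrite inE in cc.
have {}cmax y : closure U y -> v y <= v c by move=> cy; apply: cmax; rewrite inE.
have [Uc|nUc] := pselect (U c); first by have := noint c Uc cmax.
have vc : v c = 0 by apply: v0; apply/bdryE.
move=> x Ux; rewrite lt_neqAle -{2}vc cmax ?andbT; last exact: subset_closure.
apply/eqP => vx; apply: (noint x Ux) => y cy; rewrite vx -vc; exact: cmax.
Qed.

(** The constraint determines x1 from x0, which leaves the minimum of a continuous
    function over a compact set of points x0. *)
Lemma decomposition_min phi psi (t : R) x : 0 < t < 1 -> U x ->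
  {within closure U, continuous phi} -> {within closure U, continuous psi} ->
  exists x0 x1, [/\ closure U x0, closure U x1, (1 - t) *: x0 + t *: x1 = x &
    forall y0 y1, closure U y0 -> closure U y1 -> (1 - t) *: y0 + t *: y1 = x ->
      (1 - t) * phi x0 + t * psi x1 <= (1 - t) * phi y0 + t * psi y1].
Proof.
move=> /andP[t0 t1] Ux /within_continuousP cphi /within_continuousP cpsi.
have tn0 : t != 0 by exact: lt0r_neq0.
(* T x0 is the x1 that the constraint imposes. *)
pose T y := t^-1 *: (x - (1 - t) *: y).
have TE y : (1 - t) *: y + t *: T y = x.
  by rewrite /T scalerA divff // scale1r addrC subrK.
have TB y z : `|T y - T z| <= t^-1 * `|y - z|.
  have -> : T y - T z = (t^-1 * (1 - t)) *: (z - y).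
    by apply/rowP => i; rewrite !mxE; ring.
  have t'0 : 0 < t^-1 by rewrite invr_gt0.
  rewrite normrZ distrC ler_wpM2r // gtr0_norm ?mulr_gt0 ?subr_gt0 //.
  by rewrite ler_piMr ?ltW //; lra.
pose A := [set y | closure U y /\ closure U (T y)].
have clA : closed A.
  move=> y cy; split.
    rewrite -closure_closure.
    by apply: closureS cy => z [].
  rewrite -closure_closure.
  apply: closure_of_approx => e e0; have te : 0 < t * e by rewrite mulr_gt0.
  have [z [_ cz] zy] := closure_approx cy te.
  exists (T z) => //; apply: le_lt_trans (TB _ _) _.
  by rewrite mulrC ltr_pdivrMr // mulrC.
have cA : compact A.
  by apply: subclosed_compact clA (closure_domain_compact hU) _ => y [].
have Ax : A x.
  split; first exact: subset_closure.
  have -> : T x = x by apply/rowP => i; rewrite !mxE; field.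
  exact: subset_closure.
have cF : {within A, continuous (fun y => (1 - t) * phi y + t * psi (T y))}.
  apply/within_continuousP => y [cy cTy] e e0; have e2 : 0 < e / 2 by rewrite divr_gt0.
  have [d1 d10 H1] := cphi _ cy _ e2; have [d2 d20 H2] := cpsi _ cTy _ e2.
  exists (Num.min d1 (t * d2)); first by rewrite lt_min d10 mulr_gt0.
  move=> z [cz cTz]; rewrite lt_min => /andP[/(H1 _ cz) h1 zy].
  have : `|psi (T z) - psi (T y)| < e / 2.
    apply: H2 => //; apply: le_lt_trans (TB _ _) _.
    by rewrite mulrC ltr_pdivrMr // mulrC.
  move: h1; rewrite !ltr_norml => /andP[? ?] /andP[? ?]; apply/andP; split; nra.
have [x0 cx0 xmin] := compact_EVT_min (ex_intro _ x Ax) cA cF.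
rewrite inE in cx0; case: cx0 => cx0 cTx0.
exists x0, (T x0); split => // y0 y1 cy0 cy1 E.
have E1 : y1 = T y0.
  apply/rowP => i; rewrite /T -E !mxE; field => //.
have Ay0 : A y0 by split; rewrite -?E1.
by rewrite E1; exact: xmin (mem_set Ay0).
Qed.

End ClassS.

(** * The geodesic as an infimal convolution *)
Section Moving.
Context {R : realType} {n : nat}.

(** The perspective c' phi(y') is the value carried by the moving minimizer y' with
    its weight c' = c + kappa tau, where tau is the time component of the
    displacement h; the other minimizer, at the displacement d from it up to sign,
    stays fixed and contributes rho tau together with the constant terms.  Since y
    is interior to U, every small h is admissible, and the opening depends on c but
    not on how close y is to the boundary. *)
Lemma touched_of_moving (f : 'rV[R]_(n + 1) -> R) z (U : set 'rV[R]_n)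
    (phi : 'rV[R]_n -> R) y g d (c kappa rho M D e : R) :
  open U -> U y -> 0 <= M ->
  (forall y', U y' -> phi y' <= phi y + dot g (y' - y) + M * `|y' - y| ^+ 2) ->
  0 < c -> `|kappa| <= 1 -> `|d| <= D -> 0 < e ->
  (forall h, `|h| < e ->
     let c' := c + kappa * tpart h in
     let y' := y + c'^-1 *: (xpart h + tpart h *: d) in
     U y' -> f (z + h) <= f z + rho * tpart h + c' * (phi y' - phi y)) ->
  touched f z (pt g (rho + dot g d)) (2 * M * (1 + D) ^+ 2 / c).
Proof.
move=> oU Uy M0 tay c0 k1 dD e0 H.
have D0 : 0 <= D by exact: le_trans dD.
have D1 : 0 < 1 + D by lra.
have [r r0 Hr] := open_ball oU Uy.
(* The bound c / 2 keeps the weight c' above c / 2, and the last one keeps y'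
   in U. *)
pose e' := Num.min e (Num.min (c / 2) (r * (c / 2) / (1 + D))).
exists e'; first by rewrite !lt_min e0 !divr_gt0 ?mulr_gt0 ?divr_gt0.
move=> h; rewrite /e' !lt_min => /and3P[he hc]; rewrite ltr_pdivlMr // => hr.
have tau : `|kappa * tpart h| <= `|h|.
  rewrite normrM; apply: le_trans (norm_tpart_le h).
  by rewrite ler_piMl.
have := H h he; cbv zeta.
set c' := c + kappa * tpart h; set eta := xpart h + tpart h *: d.
have c'c : c / 2 <= c'.
  by move: tau; rewrite ler_norml /c' => /andP[? ?]; lra.
have c'0 : 0 < c' by apply: lt_le_trans c'c; rewrite divr_gt0.
have etaD : `|eta| <= `|h| * (1 + D).
  apply: le_trans (ler_normD _ _) _; rewrite mulrDr mulr1 lerD ?norm_xpart_le //.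
  by rewrite normrZ ler_pM // norm_tpart_le.
have ein : `|c'^-1 *: eta| < r.
  rewrite normrZ gtr0_norm ?invr_gt0 // mulrC ltr_pdivrMr //.
  by apply: (le_lt_trans etaD); apply: (lt_le_trans hr); rewrite ler_pM2l.
have Uy' := Hr _ ein.
move=> /(_ Uy') F; apply: (le_trans F).
have := tay _ Uy'; rewrite [y + _ - y]addrC addKr dotZr normrZ exprMn.
rewrite gtr0_norm ?invr_gt0 // -(ler_pM2l c'0) => T.
have E : c' * (phi y + c'^-1 * dot g eta + M * (c'^-1 ^+ 2 * `|eta| ^+ 2)) =
   c' * phi y + dot g eta + M * `|eta| ^+ 2 / c' by field; exact: lt0r_neq0.
rewrite {}E in T.
have Q1 : M * `|eta| ^+ 2 / c' <= 2 * M * (1 + D) ^+ 2 / c * `|h| ^+ 2.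
  apply: (@le_trans _ _ (M * (`|h| * (1 + D)) ^+ 2 / (c / 2))); last first.
    by rewrite exprMn invf_div le_eqVlt; apply/orP; left; apply/eqP; field; exact: lt0r_neq0.
  apply: ler_pM.
  - by rewrite mulr_ge0 // exprn_ge0.
  - by rewrite invr_ge0 ltW.
  - by rewrite ler_wpM2l // lerXn2r // nnegrE // mulr_ge0 // ltW.
  - by rewrite lef_pV2 // posrE divr_gt0.
have -> : dot (pt g (rho + dot g d)) h = dot g eta + rho * tpart h.
  by rewrite -{1}(pt_eta h) dot_pt /eta dotDr dotZr; ring.
lra.
Qed.

End Moving.

Section Geodesic.
Context {R : realType} {n : nat}.
Variables (U : set 'rV[R]_n) (phi0 phi1 : 'rV[R]_n -> R) (u : 'rV[R]_(n + 1) -> R).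
Hypothesis hn : (0 < n)%N.
Hypothesis hU : smooth_strictly_convex_domain U.
Hypothesis S0 : class_S U phi0.
Hypothesis S1 : class_S U phi1.
Hypothesis geo : weak_geodesic U phi0 phi1 u.
Implicit Types (x y : 'rV[R]_n) (z w : 'rV[R]_(n + 1)) (s t : R).

Let uc : {within closure (opencyl U), continuous u}.
Proof. by case: geo => -[]. Qed.

Lemma opencyl_nonempty : opencyl U !=set0.
Proof.
have [x Ux] := domain_nonempty hU; exists (pt x 2^-1).
by apply/opencylP; rewrite xpart_pt tpart_pt; split => //; apply/andP; split; lra.
Qed.

Lemma geodesic_convex : convex_on (closure (opencyl U)) u.
Proof.
apply: convex_on_closure => //; [exact: opencyl_nonempty|exact: opencyl_starlike|].
by apply: convex_on_of_function; case: geo => -[].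
Qed.

Lemma geodesic_slice phi s : 0 <= s <= 1 -> {within closure U, continuous phi} ->
  (forall x, U x -> u (pt x s) = phi x) -> forall x, closure U x -> u (pt x s) = phi x.
Proof.
move=> s01 /within_continuousP cphi E x cx.
apply/eqP; rewrite -subr_eq0 -normr_eq0 eq_le normr_ge0 andbT.
apply/ler_addgt0Pr => e e0; rewrite add0r.
have e2 : 0 < e / 2 by rewrite divr_gt0.
have cQ y : closure U y -> closure (opencyl U) (pt y s).
  by move=> cy; apply/(closure_opencylP hU); rewrite xpart_pt tpart_pt.
have [d1 d10 H1] := cphi x cx _ e2.
have [d2 d20 H2] := (within_continuousP _ _).1 uc _ (cQ x cx) _ e2.
have d0 : 0 < Num.min d1 d2 by rewrite lt_min d10.
have [y Uy] := closure_approx cx d0; rewrite lt_min => /andP[y1 y2].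
have cy := subset_closure Uy.
have := H1 y cy y1; have := H2 _ (cQ y cy); rewrite ptB subrr.
have py : `|pt (y - x) 0| < d2.
  by apply: le_lt_trans y2; apply: norm_pt_le => //; rewrite normr0.
move=> /(_ py); rewrite (E y Uy) !ltr_norml ler_norml => /andP[? ?] /andP[? ?].
by apply/andP; split; lra.
Qed.

Lemma geodesic_at0 x : closure U x -> u (pt x 0) = phi0 x.
Proof.
have [[c0 _ _] _ _] := S0; apply: geodesic_slice => //; first by rewrite lexx ler01.
by case: geo => _ [].
Qed.

Lemma geodesic_at1 x : closure U x -> u (pt x 1) = phi1 x.
Proof.
have [[c0 _ _] _ _] := S1; apply: geodesic_slice => //; first by rewrite lexx ler01.
by case: geo => _ [].
Qed.

(** At the two ends of the lateral boundary the value 0 comes from the data, since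
    the geodesic prescribes it for 0 < t < 1 only. *)
Lemma geodesic_side x t : bdry U x -> 0 <= t <= 1 -> u (pt x t) = 0.
Proof.
move=> bx; have [cx _] := (bdryE hU x).1 bx => /andP[t0 t1].
have [t_0|tn0] := eqVneq t 0.
  by rewrite t_0 geodesic_at0 //; case: S0 => _ _; apply.
have [t_1|tn1] := eqVneq t 1.
  by rewrite t_1 geodesic_at1 //; case: S1 => _ _; apply.
by case: geo => _ [_ _]; apply => //; rewrite !lt_neqAle t0 t1 tn1 eq_sym tn0.
Qed.

Lemma slice_convex s phi : 0 <= s <= 1 ->
  (forall x, closure U x -> u (pt x s) = phi x) -> convex_on (closure U) phi.
Proof.
move=> s01 E x y r cx cy r01.
have cQ v : closure U v -> closure (opencyl U) (pt v s).
  by move=> cv; apply/(closure_opencylP hU); rewrite xpart_pt tpart_pt.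
have := geodesic_convex (cQ _ cx) (cQ _ cy) r01.
rewrite !ptZ ptD -mulrDl [r + _]addrC subrK mul1r !E //.
exact: (closure_domain_convex hU).
Qed.

Lemma geodesic_le x0 x1 t : closure U x0 -> closure U x1 -> 0 <= t <= 1 ->
  u (pt ((1 - t) *: x0 + t *: x1) t) <= (1 - t) * phi0 x0 + t * phi1 x1.
Proof.
move=> c0 c1 t01.
have q0 : closure (opencyl U) (pt x0 0).
  by apply/(closure_opencylP hU); rewrite xpart_pt tpart_pt lexx ler01.
have q1 : closure (opencyl U) (pt x1 1).
  by apply/(closure_opencylP hU); rewrite xpart_pt tpart_pt lexx ler01.
have := geodesic_convex q1 q0 t01.
by rewrite !ptZ ptD mulr0 addr0 mulr1 geodesic_at0 // geodesic_at1 // ![_ + t *: _]addrC addrC.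
Qed.

Let phi0_neg x : U x -> phi0 x < 0.
Proof.
apply: class_S_negative => //; apply: (@slice_convex 0 phi0); last exact: geodesic_at0.
by rewrite lexx ler01.
Qed.
Let phi1_neg x : U x -> phi1 x < 0.
Proof.
apply: class_S_negative => //; apply: (@slice_convex 1 phi1); last exact: geodesic_at1.
by rewrite lexx ler01.
Qed.

(** The left-hand side is the value at the point of the affine function that equals
    the tangent plane of slope p at x0 for t = 0 and at x1 for t = 1.  On the lateral
    boundary it is a convex combination of values that are at most 0. *)
Lemma geodesic_ge_affine p x0 x1 t : 0 < t < 1 -> U ((1 - t) *: x0 + t *: x1) ->
  (forall y, closure U y -> phi0 x0 + dot p (y - x0) <= phi0 y) ->
  (forall y, closure U y -> phi1 x1 + dot p (y - x1) <= phi1 y) ->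
  (1 - t) * phi0 x0 + t * phi1 x1 <= u (pt ((1 - t) *: x0 + t *: x1) t).
Proof.
move=> t01 Ux L0 L1.
(* The affine function (y, s) |-> p.y + (1 - s) a0 + s a1. *)
pose a0 := phi0 x0 - dot p x0; pose a1 := phi1 x1 - dot p x1.
have {}L0 y : closure U y -> dot p y + a0 <= phi0 y.
  by move/L0; rewrite dotBr /a0; lra.
have {}L1 y : closure U y -> dot p y + a1 <= phi1 y.
  by move/L1; rewrite dotBr /a1; lra.
have := @affine_below_of_MA0 _ _ (opencyl U) u (pt p (a1 - a0)) a0 (closure_opencyl_compact hU) uc _ _
  (pt ((1 - t) *: x0 + t *: x1) t) _.
have -> : dot (pt p (a1 - a0)) (pt ((1 - t) *: x0 + t *: x1) t) + a0 =
   (1 - t) * phi0 x0 + t * phi1 x1.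
  by rewrite dot_pt dotDr !dotZr /a0 /a1; ring.
apply.
- by case: geo => -[].
- move=> w /(closure_opencylP hU)[cw /andP[w0 w1]] nQ.
  have Lw : dot (pt p (a1 - a0)) w + a0 =
     (1 - tpart w) * (dot p (xpart w) + a0) + tpart w * (dot p (xpart w) + a1).
    by rewrite -{1}(pt_eta w) dot_pt; ring.
  rewrite {}Lw -[w in leRHS]pt_eta.
  have := L0 _ cw; have := L1 _ cw.
  have [Uw|nUw] := pselect (U (xpart w)).
    have [t_0|tn0] := eqVneq (tpart w) 0.
      by rewrite t_0 geodesic_at0 //; lra.
    have [t_1|tn1] := eqVneq (tpart w) 1.
      by rewrite t_1 geodesic_at1 //; lra.
    case: nQ; apply/opencylP; split => //.
    by rewrite !lt_neqAle w0 w1 tn1 eq_sym tn0.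
  have bw : bdry U (xpart w) by apply/(bdryE hU).
  rewrite geodesic_side //; last by rewrite w0.
  have [_ _ ->] // := S0; have [_ _ ->] // := S1.
  by nra.
- by apply/opencylP; rewrite xpart_pt tpart_pt.
Qed.

(** Both minimizers on the boundary would give the value 0, but x0 = x1 = x already
    gives a negative one.  The slope of the data at an interior minimizer then supports
    both data. *)
Lemma geodesic_decomposition z : opencyl U z -> exists x0 x1,
  [/\ closure U x0, closure U x1, (1 - tpart z) *: x0 + tpart z *: x1 = xpart z,
      u z = (1 - tpart z) * phi0 x0 + tpart z * phi1 x1 & U x0 \/ U x1].
Proof.
move=> /opencylP[Uz tz]; set t := tpart z in tz *.
have /andP[t0 t1] := tz; have t'0 : 0 < 1 - t by rewrite subr_gt0.
have [[cont0 _ _] _ b0] := S0; have [[cont1 _ _] _ b1] := S1.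
have [x0 [x1 [cx0 cx1 Ex xmin]]] := decomposition_min hU tz Uz cont0 cont1.
have UU : U x0 \/ U x1.
  have [|n0] := pselect (U x0); first by left.
  have [|n1] := pselect (U x1); first by right.
  have cz := subset_closure Uz.
  have := xmin _ _ cz cz; rewrite -scalerDl subrK scale1r => /(_ erefl).
  have -> : phi0 x0 = 0 by apply/b0/(bdryE hU).
  have -> : phi1 x1 = 0 by apply/b1/(bdryE hU).
  have := phi0_neg Uz; have := phi1_neg Uz; nra.
exists x0, x1; split => //.
have s01 : 0 <= t <= 1 by rewrite !ltW.
have cv0 : convex_on (closure U) phi0.
  by apply: (@slice_convex 0); [rewrite lexx ler01|exact: geodesic_at0].
have cv1 : convex_on (closure U) phi1.
  by apply: (@slice_convex 1); [rewrite lexx ler01|exact: geodesic_at1].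
have touch phi x : class_S U phi -> U x -> exists p K, touched phi x p K.
  move=> Sp Ux; have [M M0 [_ _ HM]] := class_S_bounds hU Sp.
  have [e e0 He] := open_ball (domain_open hU) Ux.
  exists (grad phi x), M, e => // h he.
  by have := HM _ _ Ux (He _ he); rewrite [x + h - x]addrC addKr.
rewrite -[z in LHS]pt_eta -Ex -/t.
apply/eqP; rewrite eq_le geodesic_le //=.
have oU := domain_open hU; have UC := @subset_closure _ U.
have cC := closure_domain_convex hU.
case: UU => [U0|U1].
  have [p [K tp]] := touch _ _ S0 U0.
  apply: (@geodesic_ge_affine p); rewrite ?Ex //.
    exact: touched_subgrad oU UC cv0 U0 tp.
  apply: (common_slope oU UC cC cv1 t'0 t0 U0 cx1 tp).
  by move=> y0 y1 cy0 cy1; rewrite Ex; exact: xmin.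
have [p [K tp]] := touch _ _ S1 U1.
apply: (@geodesic_ge_affine p); rewrite ?Ex //.
  apply: (common_slope oU UC cC cv0 t0 t'0 U1 cx0 tp).
  move=> y0 y1 cy0 cy1 E; have := xmin y1 y0 cy1 cy0.
  by rewrite addrC E addrC => /(_ Ex); lra.
exact: touched_subgrad oU UC cv1 U1 tp.
Qed.

Variables (M D : R).
Hypothesis M0 : 0 <= M.
Hypothesis bound0 : taylor_bounds U phi0 M.
Hypothesis bound1 : taylor_bounds U phi1 M.
Hypothesis D0 : 0 < D.
Hypothesis diam : forall x y, closure U x -> closure U y -> `|x - y| <= D.

Lemma geodesic_bound z : closure (opencyl U) z -> `|u z| <= M.
Proof.
have QM w : opencyl U w -> `|u w| <= M.
  move=> Qw; have [x0 [x1 [c0 c1 _ -> _]]] := geodesic_decomposition Qw.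
  have [_ /andP[t0 t1]] := (opencylP _ _).1 Qw.
  have [/(_ _ c0) + _ _] := bound0; have [/(_ _ c1) + _ _] := bound1.
  by rewrite !ler_norml => /andP[? ?] /andP[? ?]; apply/andP; split; nra.
move=> cz; apply/ler_addgt0Pr => e e0.
have [d d0 Hd] := (within_continuousP _ _).1 uc _ cz _ e0.
have [y Qy yz] := closure_approx cz d0.
have := Hd y (subset_closure Qy) yz; have := QM y Qy.
rewrite !ler_norml ltr_norml => /andP[? ?] /andP[? ?].
by apply/andP; split; lra.
Qed.

(** The space component of a slope is bounded by M; its time component is the difference
    of two values of the data plus a scalar product with x0 - x1. *)
Definition slope_bound := 3 * M + n%:R * M * D.

(** Here rho = phi1 x1 - phi0 x0 and d = x0 - x1 in [touched_of_moving], with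
    kappa = -1 when x0 moves and kappa = 1 when x1 moves. *)
Lemma geodesic_touched_at z x0 x1 : opencyl U z -> closure U x0 -> closure U x1 ->
  (1 - tpart z) *: x0 + tpart z *: x1 = xpart z ->
  u z = (1 - tpart z) * phi0 x0 + tpart z * phi1 x1 ->
  (U x0 -> exists2 p, `|p| <= slope_bound &
     touched u z p (2 * M * (1 + D) ^+ 2 / (1 - tpart z))) /\
  (U x1 -> exists2 p, `|p| <= slope_bound &
     touched u z p (2 * M * (1 + D) ^+ 2 / tpart z)).
Proof.
move=> /opencylP[Uz]; set t := tpart z => /andP[t0 t1] c0 c1 Ex Eu.
have t'0 : 0 < 1 - t by rewrite subr_gt0.
have [m0 g0 q0] := bound0; have [m1 g1 q1] := bound1.
have dD : `|x0 - x1| <= D by exact: diam.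
pose rho := phi1 x1 - phi0 x0.
have rhoM : `|rho| <= 2 * M.
  by apply: le_trans (ler_normB _ _) _; have := m0 _ c0; have := m1 _ c1; lra.
have slope g : `|g| <= M -> `|pt g (rho + dot g (x0 - x1))| <= slope_bound.
  move=> gM; have h1 := dot_le gM dD.
  have h2 : 0 <= n%:R * M * D by rewrite !mulr_ge0 // ltW.
  have M0' : 0 <= M by exact: M0.
  have b1 : M <= slope_bound by rewrite /slope_bound; lra.
  have b2 : 2 * M + n%:R * M * D <= slope_bound by rewrite /slope_bound; lra.
  apply: norm_pt_le; first exact: le_trans gM b1.
  by apply: le_trans (ler_normD _ _) _; exact: le_trans (lerD rhoM h1) b2.
have zh h x0' x1' : tpart h < 1 - t -> - t < tpart h -> closure U x0' -> closure U x1' ->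
   (1 - t - tpart h) *: x0' + (t + tpart h) *: x1' = (1 - t) *: x0 + t *: x1 + xpart h ->
   u (z + h) <= (1 - t - tpart h) * phi0 x0' + (t + tpart h) * phi1 x1'.
  move=> h1 h2 c0' c1' E.
  have th : 0 <= t + tpart h <= 1 by apply/andP; split; lra.
  have := geodesic_le c0' c1' th.
  have -> : 1 - (t + tpart h) = 1 - t - tpart h by ring.
  by rewrite E Ex -[z + h]pt_eta xpartD tpartD.
have hsmall (h : 'rV[R]_(n + 1)) : `|h| < Num.min t (1 - t) ->
    tpart h < 1 - t /\ - t < tpart h.
  rewrite lt_min => /andP[h1 h2]; have := norm_tpart_le h.
  by rewrite ler_norml => /andP[? ?]; split; lra.
have e0 : 0 < Num.min t (1 - t) by rewrite lt_min t0.
split=> [U0|U1].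
  exists (pt (grad phi0 x0) (rho + dot (grad phi0 x0) (x0 - x1))).
    by apply: slope; exact: g0.
  apply: (touched_of_moving (kappa := -1) (domain_open hU) U0 M0 _ t'0 _ dD e0).
  - by move=> y Uy; exact: q0.
  - by rewrite normrN1.
  move=> h /hsmall[h1 h2] /= Uy.
  have c'0 : 1 - t - tpart h != 0 by rewrite lt0r_neq0 // subr_gt0.
  have := zh h _ _ h1 h2 (subset_closure Uy) c1.
  rewrite !mulN1r Eu => /(_ _)/le_trans -> //.
    by apply/rowP => i; rewrite !mxE; field.
  by rewrite /rho; lra.
exists (pt (grad phi1 x1) (rho + dot (grad phi1 x1) (x0 - x1))).
  by apply: slope; exact: g1.
apply: (touched_of_moving (kappa := 1) (domain_open hU) U1 M0 _ t0 _ dD e0).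
- by move=> y Uy; exact: q1.
- by rewrite normr1.
move=> h /hsmall[h1 h2] /= Uy.
have c'0 : t + tpart h != 0 by rewrite lt0r_neq0 // -ltrBlDl sub0r.
have := zh h _ _ h1 h2 c0 (subset_closure Uy).
rewrite !mul1r Eu => /(_ _)/le_trans -> //.
  by apply/rowP => i; rewrite !mxE; field.
by rewrite /rho; lra.
Qed.

(** The weight c of an interior minimizer can be small only if it is the only interior
    one, hence if the other minimizer is on the boundary.  This one has weight 1 - c, so
    that z is within c (1 + D) of the corner above or below it. *)
Lemma geodesic_touched z : opencyl U z -> exists p (c : R),
  [/\ `|p| <= slope_bound, touched u z p (2 * M * (1 + D) ^+ 2 / c), 0 < c &
   2^-1 <= c \/ exists2 w, corners U w & `|z - w| <= c * (1 + D)].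
Proof.
move=> Qz; have [x0 [x1 [c0 c1 Ex Eu UU]]] := geodesic_decomposition Qz.
have [T0 T1] := geodesic_touched_at Qz c0 c1 Ex Eu.
have [_ /andP[t0 t1]] := (opencylP _ _).1 Qz.
have dD : `|x0 - x1| <= D by exact: diam.
have D0' : 0 < D by exact: D0.
have [U0|nU0] := pselect (U x0); last first.
  have U1 : U x1 by case: UU.
  have [p pB pT] := T1 U1; exists p, (tpart z); split => //; right.
  exists (pt x0 0).
    by apply/(cornersE hU); rewrite xpart_pt tpart_pt; split => //; left.
  rewrite -{1}(pt_eta z) ptB; apply: norm_pt_le; last first.
    by rewrite subr0 gtr0_norm // ler_peMr // ?ltW //; lra.
  have -> : xpart z - x0 = - tpart z *: (x0 - x1).
    by rewrite -Ex; apply/rowP => i; rewrite !mxE; ring.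
  by rewrite normrZ normrN gtr0_norm // ler_pM2l //; lra.
have [U1|nU1] := pselect (U x1); last first.
  have [p pB pT] := T0 U0; exists p, (1 - tpart z); split => //; first by rewrite subr_gt0.
  right; exists (pt x1 1).
    by apply/(cornersE hU); rewrite xpart_pt tpart_pt; split => //; right.
  have t'0 : 0 < 1 - tpart z by rewrite subr_gt0.
  rewrite -{1}(pt_eta z) ptB; apply: norm_pt_le; last first.
    by rewrite distrC gtr0_norm // ler_peMr // ?ltW //; lra.
  have -> : xpart z - x1 = (1 - tpart z) *: (x0 - x1).
    by rewrite -Ex; apply/rowP => i; rewrite !mxE; ring.
  by rewrite normrZ gtr0_norm // ler_pM2l //; lra.
have [th|th] := leP 2^-1 (tpart z).
  by have [p pB pT] := T1 U1; exists p, (tpart z); split => //; left.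
have [p pB pT] := T0 U0; exists p, (1 - tpart z); split => //; first by rewrite subr_gt0.
by left; lra.
Qed.

End Geodesic.

(** * Estimates up to the boundary, away from the corners *)
Section Corners.
Context {R : realType} {n : nat}.
Variable U : set 'rV[R]_n.
Hypothesis hU : smooth_strictly_convex_domain U.
Implicit Types (z w : 'rV[R]_(n + 1)).

Lemma corners_closed : closed (corners U).
Proof.
move=> z cz.
have near (e : R) : 0 < e -> exists2 w, corners U w & `|w - z| < e.
  exact: closure_approx.
apply/(cornersE hU); split.
- rewrite -closure_closure; apply: closure_of_approx => e /near[w] /(cornersE hU)[cw _ _] wz.
  by exists (xpart w) => //; rewrite -xpartB; apply: le_lt_trans (norm_xpart_le _) wz.
- move=> Uz; have [e e0 He] := open_ball (domain_open hU) Uz.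
  have [w /(cornersE hU)[_ nUw _] wz] := near e e0; apply: nUw.
  rewrite -[xpart w](subrK (xpart z)) addrC; apply: He.
  by rewrite -xpartB; apply: le_lt_trans (norm_xpart_le _) wz.
- have [->|z0] := eqVneq (tpart z) 0; first by left.
  have [->|z1] := eqVneq (tpart z) 1; first by right.
  exfalso.
  (* A point at a time other than 0 and 1 has a neighbourhood free of corners. *)
  have e0 : 0 < Num.min `|tpart z| `|tpart z - 1|.
    by rewrite lt_min !normr_gt0 z0 subr_eq0 z1.
  have [w /(cornersE hU)[_ _ tw]] := near _ e0.
  move/(le_lt_trans (norm_tpart_le _)); rewrite tpartB lt_min distrC.
  by case: tw => ->; rewrite ?subr0 ltxx // andbF.
Qed.

Lemma corners_compact : compact (corners U).
Proof.
apply: subclosed_compact corners_closed (closure_opencyl_compact hU) _ => z.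
move=> /(cornersE hU)[cz _ tz]; apply/(closure_opencylP hU); split => //.
by case: tz => ->; rewrite lexx ler01.
Qed.

Definition away_from_corners (d : R) z := forall w, corners U w -> d <= `|z - w|.

Lemma away_of_notin z : ~ corners U z -> exists2 d : R, 0 < d & away_from_corners d z.
Proof.
move=> nz; have [d d0 Hd] := open_ball (closed_openC corners_closed) nz.
exists d => // w cw; rewrite leNgt; apply/negP => zw.
by apply: (Hd (w - z)); [rewrite distrC|rewrite addrC subrK].
Qed.

Lemma away_near d e z w : away_from_corners d z -> `|w - z| <= e ->
  away_from_corners (d - e) w.
Proof.
move=> az wz c cc; have := az c cc.
have : `|z - c| <= `|w - z| + `|w - c|.
  have -> : z - c = (w - c) - (w - z) by apply/rowP => i; rewrite !mxE; ring.
  by rewrite [leRHS]addrC; exact: ler_normB.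
lra.
Qed.

(** Compactness of the set of corners makes the distance uniform. *)
Lemma away_of_neighborhood W : corners U `<=` W° ->
  exists2 d : R, 0 < d & forall z, ~ W z -> away_from_corners d z.
Proof.
move=> cW; have /compact_near_coveringP cov := corners_compact.
have : \forall d \near (0 : R)^'+, corners U `<=`
    (fun w => forall z, `|z - w| < d -> W z).
  apply: (cov R _ (fun (d : R) w => forall z, `|z - w| < d -> W z)) => w /cW.
  move=> /nbhs_ballP[r /= r0 Hr]; have r2 : 0 < r / 2 by rewrite divr_gt0.
  near=> w' d => /= z zw'; apply: Hr; rewrite -ball_normE /=.
  have w'w : `|w - w'| < r / 2.
    near: w'; apply/nbhs_ballP; exists (r / 2) => //= y.
    by rewrite -ball_normE.
  have dr : d < r / 2 by near: d; exact: nbhs_right_lt.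
  have -> : w - z = (w - w') - (z - w') by rewrite opprB addrA subrK.
  by apply: le_lt_trans (ler_normB _ _) _; lra.
move=> H; have : \forall d \near (0 : R)^'+, 0 < d /\
    corners U `<=` (fun w => forall z, `|z - w| < d -> W z).
  by near=> d; split; [near: d; exact: nbhs_right_gt|near: d].
move=> /filter_ex[d [d0 Hd]]; exists d => // z nWz w cw.
by rewrite leNgt; apply/negP => zw; apply: nWz; exact: Hd cw _ zw.
Unshelve. all: by end_near. Qed.

End Corners.

Section GradientClosure.
Context {R : realType} {m : nat}.
Implicit Types (z : 'rV[R]_m) (A K : set 'rV[R]_m) (f : 'rV[R]_m -> R).

Lemma C11_norm_le A K f (B1 B2 B3 : R) : 0 <= B1 -> 0 <= B2 -> 0 <= B3 ->
  (forall z, K z -> `|f z| <= B1) ->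
  (forall z, K z -> `|grad_closure A f z| <= B2) ->
  (forall z1 z2, K z1 -> K z2 ->
     `|grad_closure A f z1 - grad_closure A f z2| <= B3 * `|z1 - z2|) ->
  (C11_norm A K f <= (B1 + B2 + B3)%:E)%E.
Proof.
move=> b1 b2 b3 H1 H2 H3; rewrite /C11_norm !EFinD.
apply: leeD; first apply: leeD.
- by apply: ge_ereal_sup => _ [->|[z Kz <-]]; rewrite lee_fin //; exact: H1.
- by apply: ge_ereal_sup => _ [->|[z Kz <-]]; rewrite lee_fin //; exact: H2.
- apply: ge_ereal_sup => _ [->|[p [K1 K2 p12] <-]]; rewrite lee_fin //.
  by rewrite ler_pdivrMr ?normr_gt0 ?subr_eq0 //; exact: H3.
Qed.

Lemma grad_closure_bounded A f z (B : R) : closure A z ->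
  cvg (grad f y @[y --> within A (nbhs z)]) ->
  (forall y, A y -> `|grad f y| <= B) -> `|grad_closure A f z| <= B.
Proof.
move=> cz cg HB; apply/ler_addgt0Pr => e e0.
have [y [Ay _ ye]] := lim_approx cz cg e0.
have := HB y Ay; rewrite -/(grad_closure A f z) in ye.
have : `|grad_closure A f z| <= `|grad f y| + `|grad f y - grad_closure A f z|.
  by rewrite -{1}(subKr (grad f y) (grad_closure A f z)) ler_normB.
lra.
Qed.

(** Both extended gradients are approximated from inside A, and the
    approximation parameter tends to 0. *)
Lemma grad_closure_lipschitz A f z1 z2 (L e : R) : 0 <= L -> 0 < e ->
  closure A z1 -> closure A z2 ->
  cvg (grad f y @[y --> within A (nbhs z1)]) ->
  cvg (grad f y @[y --> within A (nbhs z2)]) ->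
  (forall y1 y2, A y1 -> A y2 -> `|y1 - z1| < e -> `|y2 - z2| < e ->
     `|grad f y1 - grad f y2| <= L * `|y1 - y2|) ->
  `|grad_closure A f z1 - grad_closure A f z2| <= L * `|z1 - z2|.
Proof.
move=> L0 e0 c1 c2 g1 g2 HL; rewrite -subr_ge0.
apply: (@ge0_of_small _ _ (2 + 2 * L) e e0) => t t0 te.
have [y1 [A1 z1y G1]] := lim_approx c1 g1 t0.
have [y2 [A2 z2y G2]] := lim_approx c2 g2 t0.
have y12 := HL _ _ A1 A2 (lt_trans z1y te) (lt_trans z2y te).
rewrite -/(grad_closure A f z1) in G1; rewrite -/(grad_closure A f z2) in G2.
set a := grad_closure A f z1 in G1 *; set b := grad_closure A f z2 in G2 *; clearbody a b.
have h1 : `|a - b| <= `|grad f y1 - a| + `|grad f y1 - grad f y2| + `|grad f y2 - b|.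
  have -> : a - b = (grad f y1 - grad f y2) - (grad f y1 - a) + (grad f y2 - b).
    by apply/rowP => i; rewrite !mxE; ring.
  by apply: le_trans (ler_normD _ _) _; rewrite lerD2r [leRHS]addrC; exact: ler_normB.
have h2 : `|y1 - y2| <= `|y1 - z1| + `|z1 - z2| + `|y2 - z2|.
  have -> : y1 - y2 = (y1 - z1) + (z1 - z2) - (y2 - z2).
    by apply/rowP => i; rewrite !mxE; ring.
  by apply: le_trans (ler_normB _ _) _; rewrite lerD2r; exact: ler_normD.
have h3 : L * `|y1 - y2| <= L * (t + `|z1 - z2| + t).
  rewrite ler_wpM2l //; apply: (le_trans h2).
  exact: lerD (lerD (ltW z1y) (lexx _)) (ltW z2y).
have h4 : `|a - b| <= t + L * (t + `|z1 - z2| + t) + t.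
  exact: le_trans h1 (lerD (lerD (ltW G1) (le_trans y12 h3)) (ltW G2)).
have -> : L * `|z1 - z2| - `|a - b| + t * (2 + 2 * L) =
    t + L * (t + `|z1 - z2| + t) + t - `|a - b| by ring.
by rewrite subr_ge0.
Qed.

Lemma touched_le f z p (K K' : R) : K <= K' -> touched f z p K -> touched f z p K'.
Proof.
move=> KK [e e0 He]; exists e => // h /He /le_trans; apply.
by rewrite lerD2l ler_wpM2r ?exprn_ge0.
Qed.

End GradientClosure.

Section Regularity.
Context {R : realType} {n : nat}.
Variables (U : set 'rV[R]_n) (phi0 phi1 : 'rV[R]_n -> R).
Hypothesis hn : (0 < n)%N.
Hypothesis hU : smooth_strictly_convex_domain U.
Hypothesis S0 : class_S U phi0.
Hypothesis S1 : class_S U phi1.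

Lemma geodesic_interior_estimate : exists (B : R) (L : R -> R),
  [/\ 0 <= B, forall d, 0 < d -> 0 <= L d &
  forall u, weak_geodesic U phi0 phi1 u ->
  [/\ forall z, closure (opencyl U) z -> `|u z| <= B,
      forall z, opencyl U z -> differentiable u z /\ `|grad u z| <= B &
      forall d z1 z2, 0 < d -> opencyl U z1 -> opencyl U z2 ->
        (forall s, 0 <= s <= 1 -> away_from_corners U d (z1 + s *: (z2 - z1))) ->
        `|grad u z2 - grad u z1| <= L d * `|z2 - z1|]].
Proof.
have [Ma Ma0 a1] := class_S_bounds hU S0.
have [Mb Mb0 b1] := class_S_bounds hU S1.
pose M := Ma + Mb.
have M0 : 0 <= M by rewrite addr_ge0.
have aM : Ma <= M by rewrite lerDl.
have bM : Mb <= M by rewrite lerDr.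
have bound0 : taylor_bounds U phi0 M by exact: taylor_bounds_le a1.
have bound1 : taylor_bounds U phi1 M by exact: taylor_bounds_le b1.
have [D1 D10 HD1] := closure_domain_bounded hU.
pose D := D1 + D1.
have D0 : 0 < D by rewrite addr_gt0.
have diam x y : closure U x -> closure U y -> `|x - y| <= D.
  by move=> cx cy; apply: le_trans (ler_normB _ _) _; rewrite lerD // HD1.
(* The summands 2 and (1 + D) / d are the bounds of 1 / c in the two cases of
   [geodesic_touched]. *)
pose K (d : R) := 2 * M * (1 + D) ^+ 2 * (2 + (1 + D) / d).
have K00 : 0 <= 2 * M * (1 + D) ^+ 2.
  by apply: mulr_ge0; [exact: mulr_ge0|exact: sqr_ge0].
have K0 d : 0 < d -> 0 <= K d.
  by move=> d0; rewrite mulr_ge0 // addr_ge0 // divr_ge0 ?addr_ge0 // ltW.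
have sb : 0 <= slope_bound (n := n) M D.
  by rewrite /slope_bound addr_ge0 // !mulr_ge0 // ltW.
exists (M + slope_bound (n := n) M D), (fun d => 4 * K d).
split=> [|d d0|u geo]; [exact: addr_ge0|by rewrite mulr_ge0 ?K0|].
have oQ := opencyl_open hU.
have cu : convex_on (opencyl U) u.
  by apply: convex_on_of_function; case: geo => -[].
have touchQ := geodesic_touched hn hU S0 S1 geo M0 bound0 bound1 D0 diam.
have touchE z : opencyl U z -> exists q L, touched u z q L.
  by move=> /touchQ[p [c [_ ?  _ _]]]; eexists; eexists; eassumption.
split.
- move=> z cz; apply: le_trans (geodesic_bound hn hU S0 S1 geo bound0 bound1 cz) _.
  by rewrite lerDl.
- move=> z Qz; have [p [c [pB tp _ _]]] := touchQ z Qz.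
  have [df ->] := touched_diff oQ cu Qz tp; split => //.
  by apply: le_trans pB _; rewrite lerDr.
- move=> d z1 z2 d0 Q1 Q2 aw.
  have cQ : convex_dom (opencyl U).
    move=> x y s Qx Qy /andP[s0 s1]; move: s0; rewrite le_eqVlt => /orP[/eqP <-|s0].
      by rewrite scale0r add0r subr0 scale1r.
    by apply: opencyl_starlike => //; [exact: subset_closure|rewrite s0].
  apply: (grad_lipschitz_segment oQ cu (K0 d d0) touchE) => s s01.
  have Qs := segment_in cQ Q1 Q2 s01.
  split => //; have [p [c [_ tp c0 cc]]] := touchQ _ Qs; exists p.
  apply: touched_le tp; rewrite /K ler_wpM2l //.
  have dD : 0 <= (1 + D) / d by rewrite divr_ge0 ?addr_ge0 // ltW.
  case: cc => [c2|[w cw wc]].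
    have : c^-1 <= 2 by rewrite -[leRHS]invrK lef_pV2 ?posrE ?invr_gt0.
    lra.
  have := le_trans (aw s s01 w cw) wc => dc.
  have : c^-1 <= (1 + D) / d.
    by rewrite ler_pdivlMr // mulrC ler_pdivrMr // mulrC.
  lra.
Qed.

(** Points of K closer to each other than d / 4 are approximated from inside by points
    whose segment stays at distance at least d / 4 from the corners.  For the others
    the Lipschitz quotient is at most 2 B / (d / 4). *)
Lemma geodesic_closure_estimate : exists C : R -> R,
  forall u, weak_geodesic U phi0 phi1 u ->
  [/\ forall z, opencyl U z -> differentiable u z,
      forall z, closure (opencyl U) z -> ~ corners U z ->
        cvg (grad u y @[y --> within (opencyl U) (nbhs z)]) &
      forall (d : R) K, 0 < d ->
        (forall z, K z -> closure (opencyl U) z /\ away_from_corners U d z) ->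
        (C11_norm (opencyl U) K u <= (C d)%:E)%E].
Proof.
have [B [L [B0 L0 HL]]] := geodesic_interior_estimate.
exists (fun d => B + B + (L (d / 4) + 8 * B / d)) => u geo.
have [uB uD uL] := HL u geo.
have seg d z y1 y2 (r : R) : away_from_corners U d z -> `|y1 - z| <= r -> `|y2 - z| <= r ->
    forall s, 0 <= s <= 1 -> away_from_corners U (d - r) (y1 + s *: (y2 - y1)).
  move=> az y1r y2r s /andP[s0 s1]; apply: away_near az _.
  have -> : y1 + s *: (y2 - y1) - z = (1 - s) *: (y1 - z) + s *: (y2 - z).
    by apply/rowP => i; rewrite !mxE; ring.
  apply: le_trans (ler_normD _ _) _.
  rewrite !normrZ (ger0_norm s0) ger0_norm ?subr_ge0 //; nra.
have cg z : closure (opencyl U) z -> ~ corners U z ->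
    cvg (grad u y @[y --> within (opencyl U) (nbhs z)]).
  move=> cz /(away_of_notin hU)[d d0 az]; have d2 : 0 < d / 2 by rewrite divr_gt0.
  apply: (cvg_of_lipschitz (L := L (d / 2)) cz d2) => y1 y2 Q1 Q2 y1z y2z.
  rewrite distrC [X in _ <= _ * X]distrC; apply: uL => // s s01.
  have := seg _ _ _ _ _ az (ltW y1z) (ltW y2z) s s01.
  by have -> : d - d / 2 = d / 2 by field.
split=> [z /uD[]//|//|d K d0 HK].
have d4 : 0 < d / 4 by rewrite divr_gt0.
have d8 : 0 < d / 8 by rewrite divr_gt0.
have cgK z : K z -> cvg (grad u y @[y --> within (opencyl U) (nbhs z)]).
  move=> /HK[cz az]; apply: cg => // czc; have := az z czc.
  by rewrite subrr normr0 leNgt d0.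
have gB z : K z -> `|grad_closure (opencyl U) u z| <= B.
  move=> Kz; apply: grad_closure_bounded; [exact: (HK z Kz).1|exact: cgK|].
  by move=> y /uD[].
have L40 := L0 _ d4.
have B8 : 0 <= 8 * B / d by rewrite divr_ge0 ?mulr_ge0 // ltW.
apply: C11_norm_le => //; first by rewrite addr_ge0.
  by move=> z /HK[cz _]; exact: uB.
move=> z1 z2 K1 K2.
have [far|near] := leP (d / 4) `|z1 - z2|.
  apply: (@le_trans _ _ (B + B)).
    by apply: le_trans (ler_normB _ _) _; rewrite lerD // gB.
  apply: (@le_trans _ _ (8 * B / d * (d / 4))).
    have -> : 8 * B / d * (d / 4) = B + B by field; exact: lt0r_neq0.
    by [].
  apply: (@le_trans _ _ (8 * B / d * `|z1 - z2|)); first by rewrite ler_wpM2l.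
  by rewrite ler_wpM2r // lerDr.
apply: (@le_trans _ _ (L (d / 4) * `|z1 - z2|)); last first.
  by rewrite ler_wpM2r // lerDl.
have [c1 a1] := HK z1 K1; have [c2 a2] := HK z2 K2.
apply: (grad_closure_lipschitz (e := d / 8)) => //; [exact: cgK|exact: cgK|].
move=> y1 y2 Q1 Q2 h1 h2.
rewrite distrC [X in _ <= _ * X]distrC; apply: uL => // s s01.
have h1' : `|y1 - z1| <= d / 2 by lra.
have h2' : `|y2 - z1| <= d / 2.
  have -> : y2 - z1 = (y2 - z2) - (z1 - z2) by rewrite opprB addrA subrK.
  by apply: le_trans (ler_normB _ _) _; lra.
move=> w cw; apply: le_trans (seg _ _ _ _ _ a1 h1' h2' s s01 w cw).
lra.
Qed.

End Regularity.

Theorem theorem0p1 (R : realType) (n : nat) (hn : (0 < n)%N)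
  (U : set 'rV[R]_n) (hU : smooth_strictly_convex_domain U)
  (phi0 phi1 : 'rV[R]_n -> R)
  (hphi0 : class_S U phi0) (hphi1 : class_S U phi1) :
  (forall u : 'rV[R]_(n + 1) -> R, weak_geodesic U phi0 phi1 u ->
     C11_loc (cylinder U `]0, 1[) (closure (cylinder U `[0, 1]) `\` corners U) u)
  /\
  (forall W : set 'rV[R]_(n + 1),
     corners U `<=` W° -> convex_set (cylinder U `[0, 1] `\` W) ->
     exists C_W : R,
       forall u : 'rV[R]_(n + 1) -> R, weak_geodesic U phi0 phi1 u ->
         (C11_norm (cylinder U `]0, 1[)%R (closure (cylinder U `[0, 1]) `\` W)%R u
          <= C_W%:E)%E).
Proof.
rewrite (closure_cylinder01 hU).
have [C HC] := geodesic_closure_estimate hn hU hphi0 hphi1.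
split=> [u /HC[uD cg uC]|W cW _].
  split.
    split=> // z [Qz|[cz nz]]; apply: cg => //; first exact: subset_closure.
    by move=> /(cornersE hU)[_ nU _]; case/opencylP: Qz.
  move=> z [cz /(away_of_notin hU)[d d0 az]]; have d2 : 0 < d / 2 by rewrite divr_gt0.
  exists (ball z (d / 2)); first exact: nbhsx_ballx.
  apply: le_lt_trans (uC (d / 2) _ d2 _) (ltry _) => w [zw [cw _]]; split => //.
  have -> : d / 2 = d - d / 2 by field.
  apply: away_near az _; rewrite ltW // distrC.
  by move: zw; rewrite -ball_normE.
have [d d0 aW] := away_of_neighborhood hU cW.
exists (C d) => u /HC[_ _ uC]; apply: uC => // z [cz nWz]; split => //.
exact: aW.
Qed.
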